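(* There is a universal constant $c > 0$ such that for every $n \ge 1$, every measurable $f : \mathbb{R}^n \to [0,1]$ and every $t > 0$, $$\mathbb{E}\, M(f_{t,Y}) \ge c\,(e^{2t} - 1)\, \mathrm{Var}(P_t f),$$ where $Y \sim \gamma_n$.
   Context: $\gamma_n$ is the standard Gaussian measure on $\mathbb{R}^n$; $\mathrm{Var}$ and $\mathrm{Cov}$ of functions on $\mathbb{R}^n$ are taken with respect to $\gamma_n$. $P_t$ is the Ornstein-Uhlenbeck semigroup, $P_t f(x) = \mathbb{E} f(e^{-t} x + \sqrt{1-e^{-2t}}\, X)$ with $X \sim \gamma_n$. For $y \in \mathbb{R}^n$, $f_{t,y}(x) = f(\sqrt{1-e^{-2t}}\, x + e^{-t} y)$. A half-space in $\mathbb{R}^n$ is a set of the form $\{x \in \mathbb{R}^n : \langle x, a\rangle \le b\}$ with $a \in \mathbb{R}^n$, $b \in \mathbb{R}$. For measurable $g : \mathbb{R}^n \to [0,1]$, $M(g) = \sup_A \mathrm{Cov}(1_A, g)$, the supremum over all half-spaces $A \subset \mathbb{R}^n$. *)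

(* Defs.v *)
From HB Require Import structures.
From mathcomp Require Import all_boot all_order all_algebra.
From mathcomp Require Import all_classical all_reals all_analysis.

Set Implicit Arguments.
Unset Strict Implicit.
Unset Printing Implicit Defensive.

Import Order.TTheory GRing.Theory Num.Theory.
Import numFieldNormedType.Exports.

Local Open Scope classical_set_scope.
Local Open Scope ring_scope.

(* R^n is modelled by n-tuples because the library equips them with a
   sigma-algebra (the product one, i.e. the Borel sets); row vectors have none. *)
Notation Rn R n := (n.-tuple (measurableTypeR R)).

Definition Rn_cons (R : realType) (n : nat)
  (p : measurableTypeR R * Rn R n) : Rn R n.+1 := [tuple of p.1 :: p.2].

Lemma measurable_Rn_cons (R : realType) (n : nat) :
  measurable_fun [set: measurableTypeR R * Rn R n] (@Rn_cons R n).
Proof. exact: measurable_cons. Qed.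

HB.instance Definition _ (R : realType) (n : nat) :=
  isMeasurableFun.Build _ _ _ _ (@Rn_cons R n) (@measurable_Rn_cons R n).

(* The n-fold product of N(0, 1). *)
Fixpoint gaussian (R : realType) (n : nat) : probability (Rn R n) R :=
  if n is m.+1 then
    distribution (normal_prob (0 : R) 1 \x gaussian R m)%E (@Rn_cons R m)
  else \d_([tuple] : Rn R 0).

Definition lincomb (R : realType) (n : nat) (a : R) (x : Rn R n)
  (b : R) (y : Rn R n) : Rn R n :=
  [tuple a * tnth x i + b * tnth y i | i < n].

Definition dotp (R : realType) (n : nat) (x y : Rn R n) : R :=
  \sum_(i < n) tnth x i * tnth y i.

(* a = 0 is allowed, so the empty set and the whole space are half-spaces. *)
Definition halfspace (R : realType) (n : nat) : set (set (Rn R n)) :=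
  [set A | exists a b, A = [set x | dotp x a <= b]].

Definition ou_semigroup (R : realType) (n : nat) (t : R) (f : Rn R n -> R)
  (x : Rn R n) : R :=
  fine 'E_(gaussian R n)[fun X =>
    f (lincomb (expR (- t)) x (Num.sqrt (1 - expR (- (2 * t)))) X)].

Definition ou_slice (R : realType) (n : nat) (t : R) (y : Rn R n)
  (f : Rn R n -> R) (x : Rn R n) : R :=
  f (lincomb (Num.sqrt (1 - expR (- (2 * t)))) x (expR (- t)) y).

Definition max_halfspace_cov (R : realType) (n : nat) (g : Rn R n -> R)
  : \bar R :=
  ereal_sup [set covariance (gaussian R n) (\1_A) g | A in @halfspace R n].

(* Main.v *)
Require Import Defs.
From mathcomp Require Import all_boot all_order all_algebra.
From mathcomp Require Import all_classical all_reals all_analysis.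
From mathcomp Require Import measurable_realfun.
From mathcomp Require Import ring lra.

Set Implicit Arguments.
Unset Strict Implicit.
Unset Printing Implicit Defensive.

Import Order.TTheory GRing.Theory Num.Theory.
Import numFieldNormedType.Exports.

Local Open Scope classical_set_scope.
Local Open Scope ring_scope.

(** Put a = e^-t and s = sqrt (1 - e^-2t), and for g with values in [0, 1] let
    b(g) be the vector of first Hermite coefficients E X_i g(X), X standard
    Gaussian. Two estimates meet in the sum of squares |b|^2.

    Half-spaces detect b: |b(g)|^2 <= 8 M(g)
    (sqr_barycenter_le_max_halfspace_cov). With L(x) = <x, b> one has
    |b|^2 = E L (g - E g). Truncating L to [-2, 2] changes this by at most
    E L^2 / 8 <= |b|^2 / 2, because |g - E g| <= 1 and E L^2 <= 4 |b|^2. The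
    truncated L is, up to an additive constant, the integral over u in [-2, 2]
    of the indicators of the half-spaces {L >= u}, so that it contributes at
    most 4 M(g). Hence |b|^2 <= 4 M(g) + |b|^2 / 2.

    Integrating b over the slices controls the variance: b(f_{t,y}) is, up to
    the factor a / s, the gradient of P_t f at y, and a Poincare inequality
    (poincare_ou) gives Var (P_t f) <= 2 (a / s)^2 E |b(f_{t,Y})|^2. Since
    (a / s)^2 (e^2t - 1) = 1, the two estimates combine to c = 1/16.

    The Poincare inequality is proved by tensorization. The Efron-Stein
    inequality (efron_stein) bounds a variance in n + 1 coordinates by the
    averaged variances in the first coordinate and in the n others; averaging
    f over the coordinates left out turns both into instances of the same
    inequality, with the same constant, in dimensions 1 and n. On the line
    (poincare_heat1) the variance is at most the second moment about the value
    at 0, the increment from 0 to y is the integral of the scores over [0, y]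
    (heat_increment), and a Hardy inequality with Gaussian weight on each
    half-line (hardy_half) concludes. *)

(** * Integration on probability spaces *)

Lemma measurable_le_set d (T : measurableType d) (R : realType) (f g : T -> R) :
  measurable_fun setT f -> measurable_fun setT g -> measurable [set x | f x <= g x].
Proof.
move=> mf mg; rewrite -[X in measurable X]setTI.
exact: (measurable_fun_ler mf mg measurableT (_ : measurable [set true])).
Qed.

Lemma integrable_dominated d (T : measurableType d) (R : realType)
  (mu : {measure set T -> \bar R}) (F g : T -> R) :
  measurable_fun setT F -> mu.-integrable setT (EFin \o g) ->
  (forall x, `|F x| <= g x) -> mu.-integrable setT (EFin \o F).
Proof.
move=> mF ig Fg; apply: le_integrable ig => //; first exact/measurable_EFinP.
by move=> x _ /=; rewrite lee_fin (le_trans (Fg x))// ler_norm.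
Qed.

Lemma EFin_Rintegral d (T : measurableType d) (R : realType)
  (mu : {measure set T -> \bar R}) (D : set T) (G : T -> R) :
  measurable D -> mu.-integrable D (EFin \o G) ->
  (\int[mu]_(x in D) G x)%:E = (\int[mu]_(x in D) (G x)%:E)%E.
Proof. by move=> mD iG; rewrite /Rintegral fineK//; exact: integrable_fin_num. Qed.

(** Domination by a product g1 x * g2 y covers the two kinds of integrands met
    below: bounded ones, and a coordinate times a bounded function. *)
Section fubini_dominated.
Context d1 d2 (T1 : measurableType d1) (T2 : measurableType d2) (R : realType).
Variables (m1 : {sigma_finite_measure set T1 -> \bar R}).
Variables (m2 : {sigma_finite_measure set T2 -> \bar R}).
Variables (F : T1 * T2 -> R) (g1 : T1 -> R) (g2 : T2 -> R).
Hypothesis mF : measurable_fun setT F.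
Hypothesis ig1 : m1.-integrable setT (EFin \o g1).
Hypothesis ig2 : m2.-integrable setT (EFin \o g2).
Hypothesis Fg : forall x y, `|F (x, y)| <= g1 x * g2 y.

Let mF1 x : measurable_fun setT (fun y => F (x, y)).
Proof. exact: measurableT_comp mF (pair1_measurable _). Qed.

Let mF2 y : measurable_fun setT (fun x => F (x, y)).
Proof. exact: measurableT_comp mF (pair2_measurable _). Qed.

Let ig1c c : m1.-integrable setT (EFin \o (fun x => g1 x * c)).
Proof. exact: (integrableZr measurableT c ig1). Qed.

Let ig2c c : m2.-integrable setT (EFin \o (fun y => c * g2 y)).
Proof. exact: (integrableZl measurableT c ig2). Qed.

Lemma dominated_integrable1 y : m1.-integrable setT (EFin \o (fun x => F (x, y))).
Proof. exact: integrable_dominated (ig1c (g2 y)) _. Qed.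

Lemma dominated_integrable2 x : m2.-integrable setT (EFin \o (fun y => F (x, y))).
Proof. exact: integrable_dominated (ig2c (g1 x)) _. Qed.

Lemma dominated_le2 y : `|\int[m1]_x F (x, y)| <= (\int[m1]_x g1 x) * g2 y.
Proof.
apply: (le_trans (le_normr_Rintegral _ (dominated_integrable1 y))) => //.
rewrite -RintegralZr//; apply: le_Rintegral => //.
by apply: (integrable_norm (dominated_integrable1 y)).
Qed.

Lemma dominated_integrable_prod : (m1 \x m2)%E.-integrable setT (EFin \o F).
Proof.
apply/integrable12ltyP; first exact/measurable_EFinP.
have [_ ilt] := integrableP _ _ _ (ig1c (\int[m2]_y g2 y)).
apply: le_lt_trans ilt; apply: ge0_le_integral => //.
- by move=> x _; exact: integral_ge0.
- apply: (measurable_fun_fubini_tonelli_F (abse \o (EFin \o F))) => //=.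
  by apply: measurableT_comp => //; exact/measurable_EFinP.
- by apply: measurableT_comp => //; exact: measurable_int (ig1c _).
move=> x _; apply: le_trans (lee_abs _); rewrite /= -RintegralZl// EFin_Rintegral//.
apply: ge0_le_integral => //=.
- by apply/measurable_EFinP/(measurableT_comp (@normr_measurable R setT)).
- exact: measurable_int (ig2c _).
- by move=> y _; rewrite lee_fin.
Qed.

Lemma dominated_measurable1 : measurable_fun setT (fun x => \int[m2]_y F (x, y)).
Proof.
apply: (measurableT_comp (fine_measurable measurableT)).
exact: measurable_fubini_F dominated_integrable_prod.
Qed.

Lemma dominated_measurable2 : measurable_fun setT (fun y => \int[m1]_x F (x, y)).
Proof.
apply: (measurableT_comp (fine_measurable measurableT)).
exact: measurable_fubini_G dominated_integrable_prod.
Qed.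

Lemma dominated_fubini1 :
  \int[(m1 \x m2)%E]_z F z = \int[m1]_x \int[m2]_y F (x, y).
Proof.
rewrite /Rintegral -(integral12_prod_meas1 dominated_integrable_prod); congr fine.
apply: eq_integral => x _; rewrite fineK//.
exact/integrable_fin_num/dominated_integrable2.
Qed.

Lemma dominated_fubini2 :
  \int[(m1 \x m2)%E]_z F z = \int[m2]_y \int[m1]_x F (x, y).
Proof.
rewrite /Rintegral -(integral21_prod_meas1 dominated_integrable_prod); congr fine.
apply: eq_integral => x _; rewrite fineK//.
exact/integrable_fin_num/dominated_integrable1.
Qed.

End fubini_dominated.

Section bounded_probability.
Context d (T : measurableType d) (R : realType) (P : probability T R).

Lemma integral_prob_cst (c : \bar R) : (\int[P]_x c = c)%E.
Proof. by have := @integral_cst _ T R P _ measurableT c; rewrite /= probability_setT mule1. Qed.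

Lemma Rintegral_prob_cst (c : R) : \int[P]_x c = c.
Proof.
by have := @Rintegral_cst _ T R P _ measurableT c; rewrite /= probability_setT mulr1.
Qed.

Lemma bounded_integrable (X : T -> R) (C : R) : measurable_fun setT X ->
  (forall x, `|X x| <= C) -> P.-integrable setT (EFin \o X).
Proof.
move=> mX XC; apply: (@integrable_dominated _ _ R P _ (cst C)) => //.
exact: finite_measure_integrable_cst.
Qed.

Lemma bounded_Rintegral (X : T -> R) (C : R) : measurable_fun setT X ->
  (forall x, `|X x| <= C) -> `|\int[P]_x X x| <= C.
Proof.
move=> mX XC; have iX := bounded_integrable mX XC.
apply: (le_trans (le_normr_Rintegral _ iX)) => //.
rewrite -[leRHS]Rintegral_prob_cst; apply: le_Rintegral => //.
- by apply: (integrable_norm iX).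
- exact: finite_measure_integrable_cst.
Qed.

Lemma normr_sqr_le (x C : R) : `|x| <= C -> `|x ^+ 2| <= C ^+ 2.
Proof. by move=> xC; rewrite normrX lerXn2r// nnegrE// (le_trans _ xC). Qed.

End bounded_probability.

Lemma Rintegral_sum d (T : measurableType d) (R : realType)
  (mu : {measure set T -> \bar R}) (I : Type) (r : seq I) (X : I -> T -> R) :
  (forall i, mu.-integrable setT (EFin \o X i)) ->
  mu.-integrable setT (EFin \o (fun x => \sum_(i <- r) X i x)) /\
  \int[mu]_x (\sum_(i <- r) X i x) = \sum_(i <- r) \int[mu]_x X i x.
Proof.
move=> iX; elim: r => [|i r [iS IH]].
  rewrite big_nil; under [X in Rintegral _ _ X]eq_fun do rewrite big_nil.
  split.
    under [X in _ \o X]eq_fun do rewrite big_nil.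
    exact: integrable0.
  by rewrite /Rintegral integral0.
rewrite big_cons; under [X in Rintegral _ _ X]eq_fun do rewrite big_cons.
split; last by rewrite RintegralD// IH.
under [X in _ \o X]eq_fun do rewrite big_cons.
exact: (integrableD measurableT (iX i) iS).
Qed.

(** The integral of a nonnegative function is a supremum over the simple
    functions below it, so it is monotone without any measurability. This is
    what allows integrating y |-> max_halfspace_cov (ou_slice t y f), a supremum
    over uncountably many half-spaces. *)
Lemma ge0_le_integral_nomeasurable d (T : measurableType d) (R : realType)
  (mu : {measure set T -> \bar R}) (f g : T -> \bar R) :
  (forall x, 0 <= f x)%E -> (forall x, f x <= g x)%E ->
  (\int[mu]_x f x <= \int[mu]_x g x)%E.
Proof.
move=> f0 fg; have g0 x : (0 <= g x)%E by exact: le_trans (fg x).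
rewrite !ge0_integralTE//; apply: ereal_sup_le => _ [h hf <-].
by exists h => //= x; exact: le_trans (fg x).
Qed.

Section bounded_fubini.
Context d1 d2 (T1 : measurableType d1) (T2 : measurableType d2) (R : realType).
Variables (m1 : probability T1 R) (m2 : probability T2 R).
Variables (F : T1 * T2 -> R) (C : R).
Hypothesis mF : measurable_fun setT F.
Hypothesis FC : forall p, `|F p| <= C.

Let iC : m1.-integrable setT (EFin \o cst C).
Proof. exact: finite_measure_integrable_cst. Qed.

Let i1 : m2.-integrable setT (EFin \o cst (1 : R)).
Proof. exact: finite_measure_integrable_cst. Qed.

Let FC1 x y : `|F (x, y)| <= cst C x * cst 1 y.
Proof. by rewrite /= mulr1. Qed.

Lemma bounded_measurable1 : measurable_fun setT (fun x => \int[m2]_y F (x, y)).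
Proof. exact: dominated_measurable1 mF iC i1 FC1. Qed.

Lemma bounded_measurable2 : measurable_fun setT (fun y => \int[m1]_x F (x, y)).
Proof. exact: dominated_measurable2 mF iC i1 FC1. Qed.

Lemma bounded_le1 x : `|\int[m2]_y F (x, y)| <= C.
Proof.
by apply: bounded_Rintegral => //; exact: measurableT_comp mF (pair1_measurable x).
Qed.

Lemma bounded_le2 y : `|\int[m1]_x F (x, y)| <= C.
Proof.
by apply: bounded_Rintegral => //; exact: measurableT_comp mF (pair2_measurable y).
Qed.

Lemma bounded_fubini :
  \int[m1]_x \int[m2]_y F (x, y) = \int[m2]_y \int[m1]_x F (x, y).
Proof.
by rewrite -(dominated_fubini1 mF iC i1 FC1) (dominated_fubini2 mF iC i1 FC1).
Qed.

End bounded_fubini.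

(** * Variance and the Efron-Stein inequality *)

Section variance_center.
Context d (T : measurableType d) (R : realType) (P : probability T R).

(** This expansion yields both the minimality of the variance among second
    moments about a point and the Jensen inequality for the square. *)
Lemma Rintegral_sqr_center (X : T -> R) (C c : R) : measurable_fun setT X ->
  (forall x, `|X x| <= C) ->
  \int[P]_x (X x - c) ^+ 2 = \int[P]_x (X x ^+ 2) - (\int[P]_x X x) ^+ 2
                            + (\int[P]_x X x - c) ^+ 2.
Proof.
move=> mX XC.
have iX := bounded_integrable P mX XC.
have iX2 : P.-integrable setT (EFin \o (fun x => X x ^+ 2)).
  apply: (@bounded_integrable _ _ _ _ _ (C ^+ 2)); first exact: measurable_funX.
  by move=> x; rewrite normrX lerXn2r// nnegrE// (le_trans _ (XC x)).
have icX : P.-integrable setT (EFin \o (fun x => 2 * c * X x)).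
  exact: (integrableZl measurableT (2 * c) iX).
have ic : P.-integrable setT (EFin \o (fun x => c ^+ 2)).
  exact: finite_measure_integrable_cst.
transitivity (\int[P]_x ((X x ^+ 2 - 2 * c * X x) + c ^+ 2)).
  by apply: eq_Rintegral => x _; ring.
rewrite RintegralD//; last exact: (integrableB measurableT iX2 icX).
by rewrite RintegralB// RintegralZl// Rintegral_prob_cst; ring.
Qed.

Lemma variance_le_center (X : T -> R) (C c : R) : measurable_fun setT X ->
  (forall x, `|X x| <= C) ->
  \int[P]_x (X x ^+ 2) - (\int[P]_x X x) ^+ 2 <= \int[P]_x (X x - c) ^+ 2.
Proof.
by move=> mX XC; rewrite (Rintegral_sqr_center c mX XC) lerDl sqr_ge0.
Qed.

Lemma jensen_sqr (X : T -> R) (C : R) :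
  measurable_fun setT X -> (forall x, `|X x| <= C) ->
  (\int[P]_x X x) ^+ 2 <= \int[P]_x (X x ^+ 2).
Proof.
move=> mX XC; have := Rintegral_sqr_center (\int[P]_x X x) mX XC.
rewrite subrr expr0n/= addr0 -subr_ge0 => <-.
by apply: Rintegral_ge0 => x _; exact: sqr_ge0.
Qed.

End variance_center.

Section section_variance.
Context d1 d2 (T1 : measurableType d1) (T2 : measurableType d2) (R : realType).
Variables (m1 : probability T1 R) (m2 : probability T2 R).
Variables (h : T1 * T2 -> R) (C : R).
Hypothesis mh : measurable_fun setT h.
Hypothesis hC : forall p, `|h p| <= C.

Let mh2 : measurable_fun setT (fun p => h p ^+ 2).
Proof. exact: measurable_funX. Qed.

Let h2C p : `|h p ^+ 2| <= C ^+ 2.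
Proof. exact: normr_sqr_le. Qed.

Lemma integrable_variance1 : m1.-integrable setT (EFin \o
  (fun x => \int[m2]_y h (x, y) ^+ 2 - (\int[m2]_y h (x, y)) ^+ 2)).
Proof.
apply: (@bounded_integrable _ _ _ _ _ (C ^+ 2 + C ^+ 2)).
  apply: measurable_funB; first exact: bounded_measurable1 mh2 h2C.
  by apply: measurable_funX; exact: bounded_measurable1 mh hC.
move=> x; rewrite (le_trans (ler_normB _ _))// lerD//.
  exact: bounded_le1 mh2 h2C x.
by apply: normr_sqr_le; exact: bounded_le1 mh hC x.
Qed.

Lemma integrable_variance2 : m2.-integrable setT (EFin \o
  (fun y => \int[m1]_x h (x, y) ^+ 2 - (\int[m1]_x h (x, y)) ^+ 2)).
Proof.
apply: (@bounded_integrable _ _ _ _ _ (C ^+ 2 + C ^+ 2)).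
  apply: measurable_funB; first exact: bounded_measurable2 mh2 h2C.
  by apply: measurable_funX; exact: bounded_measurable2 mh hC.
move=> y; rewrite (le_trans (ler_normB _ _))// lerD//.
  exact: bounded_le2 mh2 h2C y.
by apply: normr_sqr_le; exact: bounded_le2 mh hC y.
Qed.

End section_variance.

Section efron_stein.
Context d1 d2 (T1 : measurableType d1) (T2 : measurableType d2) (R : realType).
Variables (m1 : probability T1 R) (m2 : probability T2 R).

(** The variance is the mean of the conditional variances given x plus the
    variance of the conditional mean B x. With A y the conditional mean given y
    and m the full mean, B x - m is the y-average of h (x, y) - A y, so by
    Jensen the variance of B is at most the mean of the conditional variances
    given y. *)
Lemma efron_stein (h : T1 * T2 -> R) (C : R) : measurable_fun setT h ->
  (forall p, `|h p| <= C) ->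
  (\int[m1]_x \int[m2]_y h (x, y) ^+ 2) - (\int[m1]_x \int[m2]_y h (x, y)) ^+ 2
  <= \int[m2]_y (\int[m1]_x h (x, y) ^+ 2 - (\int[m1]_x h (x, y)) ^+ 2)
   + \int[m1]_x (\int[m2]_y h (x, y) ^+ 2 - (\int[m2]_y h (x, y)) ^+ 2).
Proof.
move=> mh hC.
have mh2 : measurable_fun setT (fun p => h p ^+ 2) by exact: measurable_funX.
have h2C p : `|h p ^+ 2| <= C ^+ 2 by exact: normr_sqr_le.
pose A y := \int[m1]_x h (x, y); pose B x := \int[m2]_y h (x, y).
pose m := \int[m1]_x B x.
have mA : measurable_fun setT A by exact: bounded_measurable2 mh hC.
have mB : measurable_fun setT B by exact: bounded_measurable1 mh hC.
have AC y : `|A y| <= C by exact: bounded_le2 mh hC y.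
have BC x : `|B x| <= C by exact: bounded_le1 mh hC x.
have mE : m = \int[m2]_y A y by exact: bounded_fubini mh hC.
pose k (p : T1 * T2) := h p - A p.2.
have mk : measurable_fun setT k.
  by apply: measurable_funB => //; exact: measurableT_comp.
have kC p : `|k p| <= C + C by rewrite (le_trans (ler_normB _ _))// lerD.
have mk2 : measurable_fun setT (fun p => k p ^+ 2) by exact: measurable_funX.
have k2C p : `|k p ^+ 2| <= (C + C) ^+ 2 by exact: normr_sqr_le.
have mhx x : measurable_fun setT (fun y => h (x, y)).
  exact: measurableT_comp mh (pair1_measurable x).
have mhy y : measurable_fun setT (fun x => h (x, y)).
  exact: measurableT_comp mh (pair2_measurable y).
have key : \int[m1]_x (B x ^+ 2) - m ^+ 2
    <= \int[m2]_y (\int[m1]_x h (x, y) ^+ 2 - (\int[m1]_x h (x, y)) ^+ 2).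
  have -> : \int[m1]_x (B x ^+ 2) - m ^+ 2 = \int[m1]_x ((B x - m) ^+ 2).
    by rewrite (Rintegral_sqr_center m1 m mB BC) subrr expr0n/= addr0.
  have -> : \int[m2]_y (\int[m1]_x h (x, y) ^+ 2 - (\int[m1]_x h (x, y)) ^+ 2)
      = \int[m2]_y \int[m1]_x (k (x, y) ^+ 2).
    apply: eq_Rintegral => y _.
    rewrite (Rintegral_sqr_center m1 (A y) (mhy y) (fun x => hC (x, y))).
    by rewrite subrr expr0n/= addr0.
  rewrite -(bounded_fubini m1 m2 mk2 k2C); apply: le_Rintegral => //.
  - apply: (@bounded_integrable _ _ _ _ _ ((C + C) ^+ 2)).
      by apply: measurable_funX; exact: measurable_funB.
    move=> x; apply: normr_sqr_le; rewrite (le_trans (ler_normB _ _))// lerD//.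
    exact: bounded_Rintegral mB BC.
  - apply: (@bounded_integrable _ _ _ _ _ ((C + C) ^+ 2)).
      exact: bounded_measurable1 mk2 k2C.
    by move=> x; exact: (bounded_le1 m2 mk2 k2C x).
  move=> x _; have -> : B x - m = \int[m2]_y k (x, y).
    rewrite mE -RintegralB//; first exact: bounded_integrable (mhx x) (fun y => hC (x, y)).
    exact: bounded_integrable mA AC.
  apply: jensen_sqr (fun y => kC (x, y)).
  exact: measurableT_comp mk (pair1_measurable x).
apply: (@le_trans _ _ ((\int[m1]_x (B x ^+ 2) - m ^+ 2) +
   (\int[m1]_x \int[m2]_y h (x, y) ^+ 2 - \int[m1]_x (B x ^+ 2)))).
  by rewrite -/(B _) -/m; lra.
apply: lerD => //; rewrite -RintegralB//.
- apply: (@bounded_integrable _ _ _ _ _ (C ^+ 2)).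
    exact: bounded_measurable1 mh2 h2C.
  by move=> x; exact: (bounded_le1 m2 mh2 h2C x).
- apply: (@bounded_integrable _ _ _ _ _ (C ^+ 2)); first exact: measurable_funX.
  by move=> x; exact: normr_sqr_le.
Qed.

End efron_stein.

(** * The standard Gaussian measure on the line *)

Section normal01.
Context (R : realType).
Notation mu := (@lebesgue_measure R).
Notation N := (normal_prob (0 : R) 1).
Notation phi := (normal_pdf (0 : R) 1).

(** normal_prob is defined as an integral of its density against the Lebesgue
    measure, so the density agrees a.e. with the Radon-Nikodym derivative, for
    which the change of variables is known. *)
Lemma ge0_integral_normal (f : R -> \bar R) : (forall x, 0 <= f x)%E ->
  measurable_fun setT f ->
  (\int[N]_x f x = \int[mu]_x (f x * (phi x)%:E))%E.
Proof.
move=> f0 mf.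
have numu : (N : {finite_measure set _ -> \bar R}) `<< mu by exact: normal_prob_dominates.
rewrite -(Radon_Nikodym_SigmaFinite.change_of_variables numu)//.
have mphi : measurable_fun setT (fun x => (phi x)%:E).
  by apply/measurable_EFinP; exact: measurable_normal_pdf.
have mg := measurable_int _ (Radon_Nikodym_SigmaFinite.f_integrable numu).
apply: ae_eq_integral => //.
- by apply: emeasurable_funM.
- by apply: emeasurable_funM.
apply: ae_eqe_mul2l.
apply: integral_ae_eq => //; first exact: Radon_Nikodym_SigmaFinite.f_integrable.
by move=> A _ mA; rewrite -(Radon_Nikodym_SigmaFinite.f_integral numu).
Qed.

Lemma normal_pdf1E x : phi x = phi 0 * expR (- x ^+ 2 / 2).
Proof.
rewrite normal_pdfE ?oner_neq0//= /normal_fun !subr0 !expr1n expr0n/= oppr0 mul0r expR0.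
by rewrite mulr1.
Qed.

Lemma integral_normal (f : R -> \bar R) : measurable_fun setT f ->
  (\int[N]_x f x = \int[mu]_x (f x * (phi x)%:E))%E.
Proof.
move=> mf; rewrite [LHS]integralE [RHS]integralE.
have phi0 x : (0 <= (phi x)%:E)%E by rewrite lee_fin normal_pdf_ge0.
rewrite !ge0_integral_normal//; [|exact: measurable_funeneg|exact: measurable_funepos].
congr (_ - _)%E; apply: eq_integral => x _.
- by rewrite !funeposE maxe_pMl// mul0e.
- by rewrite !funenegE -mulNe maxe_pMl// mul0e.
Qed.

(** Both measures agree on half-open intervals, which determine them. *)
Lemma lebesgue_measure_shift (z : R) (A : set (measurableTypeR R)) : measurable A ->
  pushforward mu ((fun x => x + z) : _ -> measurableTypeR R) A = mu A.
Proof.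
have mshift : measurable_fun setT ((fun x => x + z) : measurableTypeR R -> measurableTypeR R).
  by apply: measurable_funD.
pose m := pushforward mu ((fun x => x + z) : _ -> measurableTypeR R).
move=> mA; apply/esym/(@lebesgue_measure_unique _ m) => //= _ [[a b]] _ <-.
rewrite /m /pushforward/= [X in _ = mu X](_ : _ = `](a - z), (b - z)]%classic).
  rewrite !lebesgue_measure_itv/= !lte_fin ltrBDr subrK.
  by case: ifP => // _; rewrite -!EFinB; congr EFin; ring.
by apply/seteqP; split => x /=; rewrite !in_itv/= ltrBlDr lerBrDr.
Qed.

Lemma ge0_integral_shift (z : R) (f : R -> \bar R) : (forall x, 0 <= f x)%E ->
  measurable_fun setT f ->
  (\int[mu]_x f (x + z)%R = \int[mu]_x f x)%E.
Proof.
move=> f0 mf.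
have mshift : measurable_fun setT ((fun x => x + z) : measurableTypeR R -> measurableTypeR R).
  by apply: measurable_funD.
have := @ge0_integral_pushforward _ _ _ _ R _ mshift mu setT f.
rewrite preimage_setT => <-//.
by apply: eq_measure_integral => //= A mA _; exact: lebesgue_measure_shift.
Qed.

Lemma integral_shift (z : R) (f : R -> \bar R) : measurable_fun setT f ->
  (\int[mu]_x f (x + z)%R = \int[mu]_x f x)%E.
Proof.
move=> mf; rewrite [LHS]integralE [RHS]integralE.
congr (_ - _)%E.
- rewrite -(@ge0_integral_shift z (f^\+)%E)//; last exact: measurable_funepos.
  by apply: eq_integral => x _; rewrite !funeposE.
- rewrite -(@ge0_integral_shift z (f^\-)%E)//; last exact: measurable_funeneg.
  by apply: eq_integral => x _; rewrite !funenegE.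
Qed.

Lemma ge0_integral_halves (f : R -> \bar R) : (forall x, 0 <= f x)%E ->
  measurable_fun setT f ->
  (\int[mu]_x f x = \int[mu]_(x in `[0%R, +oo[) f x
                  + \int[mu]_(x in `[0%R, +oo[) f (- x)%R)%E.
Proof.
move=> f0 mf.
have mfN : measurable_fun setT (f \o -%R) by exact: measurableT_comp.
rewrite addeC (ge0_integration_by_substitution0 mfN); last by move=> r /=.
under [X in (X + _)%E]eq_integral do rewrite /= opprK.
rewrite -integral_itv_bndo_bndc; last exact: measurable_funTS.
rewrite -ge0_integral_setU//; last 2 first.
- exact: measurable_funTS.
- by apply/disj_setPS => x [] /=; rewrite !in_itv/= andbT => x0; rewrite leNgt x0.
by rewrite itv_setU_setT.
Qed.

Lemma normal_pdfN x : phi (- x) = phi x.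
Proof. by rewrite normal_pdf1E [RHS]normal_pdf1E sqrrN. Qed.

Lemma ge0_integral_normal_halves (f : R -> \bar R) : (forall x, 0 <= f x)%E ->
  measurable_fun setT f ->
  (\int[N]_x f x = \int[mu]_(x in `[0%R, +oo[) (f x * (phi x)%:E)
                  + \int[mu]_(x in `[0%R, +oo[) (f (- x)%R * (phi x)%:E))%E.
Proof.
move=> f0 mf; rewrite ge0_integral_normal// ge0_integral_halves.
- by under [X in _ = (_ + X)%E]eq_integral do rewrite -normal_pdfN.
- by move=> x; rewrite mule_ge0// lee_fin normal_pdf_ge0.
- by apply: emeasurable_funM => //; apply/measurable_EFinP; exact: measurable_normal_pdf.
Qed.

Lemma is_derive_gauss (c y : R) :
  is_derive y 1 (fun x : R => expR (- x ^+ 2 / c)) (expR (- y ^+ 2 / c) * (- (2 * y) / c)).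
Proof.
apply: (@is_derive1_comp R expR (fun x : R => - x ^+ 2 / c) y).
by apply: is_derive_eq; rewrite /GRing.scale/=; ring.
Qed.

Lemma continuous_gauss (c : R) : continuous (fun x : R => expR (- x ^+ 2 / c)).
Proof.
move=> x; apply/differentiable_continuous/derivable1_diffP.
exact: (@ex_derive _ _ _ _ _ _ _ (is_derive_gauss c x)).
Qed.

Lemma cvg_gauss (c : R) : 0 < c -> expR (- x ^+ 2 / c) @[x --> +oo] --> (0 : R).
Proof.
move=> c0.
have -> : (fun x : R => expR (- x ^+ 2 / c)) = (fun x => expR (- (x ^+ 2 * c^-1))).
  by apply/funext => x; rewrite mulNr.
apply: (cvg_comp (fun x : R => x ^+ 2 * c^-1) (fun x => expR (- x))); last exact: cvgr_expR.
by apply: gt0_cvgMly; [rewrite invr_gt0|exact: cvgr_expr2].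
Qed.

(** An exactly computable tail: the antiderivative is - 2 exp (- y^2 / 4). It
    bounds the second moment and closes the Hardy inequality. *)
Lemma gauss_tail (v : R) : 0 <= v ->
  (\int[mu]_(y in `[v, +oo[) (y * expR (- y ^+ 2 / 4))%:E
   = (2 * expR (- v ^+ 2 / 4))%:E)%E.
Proof.
move=> v0.
pose F (y : R) := - 2 * expR (- y ^+ 2 / 4).
have dF (y : R) : is_derive y 1 F (y * expR (- y ^+ 2 / 4)).
  rewrite /F; have dg := is_derive_gauss 4 y.
  by apply: is_derive_eq; rewrite /GRing.scale/=; field.
have cF : continuous F.
  move=> y; apply/differentiable_continuous/derivable1_diffP.
  exact: (@ex_derive _ _ _ _ _ _ _ (dF y)).
rewrite (@ge0_continuous_FTC2y R _ F v 0).
- by rewrite /F -EFinB; congr EFin; ring.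
- by move=> y vy; rewrite mulr_ge0 ?expR_ge0//; exact: le_trans vy.
- apply: continuous_subspaceT => y; apply: cvgM; first exact: cvg_id.
  exact: continuous_gauss.
- rewrite -[X in _ --> X](mulr0 (- 2)).
  by apply: cvgM; [exact: cvg_cst|exact: cvg_gauss].
- by move=> y _; exact: (@ex_derive _ _ _ _ _ _ _ (dF y)).
- exact/cvg_at_right_filter/cF.
- by move=> y _; rewrite derive1E; exact: (@derive_val _ _ _ _ _ _ _ (dF y)).
Qed.

Lemma ge0_integral_normalN (f : R -> \bar R) : (forall x, 0 <= f x)%E ->
  measurable_fun setT f -> (\int[N]_x f (- x)%R = \int[N]_x f x)%E.
Proof.
move=> f0 mf; rewrite !ge0_integral_normal_halves//; last first.
  by apply: measurableT_comp.
under [X in (_ + X)%E = _]eq_integral do rewrite opprK.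
by rewrite addeC.
Qed.

Lemma measurable_gauss (c : R) : measurable_fun setT (fun x : R => expR (- x ^+ 2 / c)).
Proof. by apply: continuous_measurable_fun; exact: continuous_gauss. Qed.

Lemma normal_pdf0_le1 : phi 0 <= 1.
Proof.
apply: (le_trans (normal_pdf_ub _ _ _)); first exact: oner_neq0.
rewrite /normal_peak expr1n mul1r invf_le1 ?sqrtr_gt0; last first.
  by rewrite mulrn_wgt0// pi_gt0.
rewrite -[leLHS]sqrtr1 ler_wsqrtr// mulr2n.
have := @pi_ge2 R; lra.
Qed.

(** The bound 4 in place of the exact value 1 comes from a short argument: since
    x exp (- x^2 / 4) <= 1, the integrand x^2 phi x is at most
    x exp (- x^2 / 4), whose integral over a half-line is 2. *)
Lemma normal_second_moment : (\int[N]_x (x ^+ 2)%:E <= 4%:E)%E.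
Proof.
have mp : measurable_fun setT (fun y : R => y * expR (- y ^+ 2 / 4)).
  by apply: measurable_funM => //; exact: measurable_gauss.
have half : (\int[mu]_(x in `[0%R, +oo[) ((x ^+ 2)%:E * (phi x)%:E) <= 2%:E)%E.
  apply: (@le_trans _ _ (\int[mu]_(y in `[0%R, +oo[) (y * expR (- y ^+ 2 / 4))%:E)%E).
    apply: ge0_le_integral => //.
    - by move=> x _; rewrite -EFinM lee_fin mulr_ge0 ?sqr_ge0// normal_pdf_ge0.
    - apply: measurable_funTS; apply/measurable_EFinP.
      by apply: measurable_funM => //; exact: measurable_normal_pdf.
    - by apply: measurable_funTS; exact/measurable_EFinP.
    move=> x /=; rewrite in_itv/= andbT => x0.
    rewrite -EFinM lee_fin normal_pdf1E.
    have -> : expR (- x ^+ 2 / 2) = expR (- x ^+ 2 / 4) * expR (- x ^+ 2 / 4).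
      by rewrite -expRD; congr expR; field.
    set e := expR _.
    have e0 : 0 < e by exact: expR_gt0.
    (* x <= 1 + x^2 / 4 <= exp (x^2 / 4), the first step being (x - 2)^2 >= 0 *)
    have xe : x * e <= 1.
      rewrite /e mulNr expRN ler_pdivrMr ?expR_gt0// mul1r.
      apply: le_trans (expR_ge1Dx _).
      by have := sqr_ge0 (x - 2); lra.
    have p1 := normal_pdf0_le1; have p0 := normal_pdf_ge0 0 1 (0:R).
    have -> : x ^+ 2 * (phi 0 * (e * e)) = (x * e) * (phi 0 * (x * e)) by ring.
    have xe0 : 0 <= x * e by rewrite mulr_ge0// ltW.
    rewrite -[leRHS]mul1r; apply: ler_pM => //; first exact: mulr_ge0.
    by rewrite -[leRHS]mul1r ler_wpM2r.
  by rewrite gauss_tail// expr0n/= oppr0 mul0r expR0 mulr1.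
rewrite ge0_integral_normal_halves; last 2 first.
- by move=> x; rewrite lee_fin sqr_ge0.
- exact/measurable_EFinP.
under [X in (_ + X)%E]eq_integral do rewrite sqrrN.
by apply: (le_trans (leeD half half)); rewrite -EFinD lee_fin; lra.
Qed.

Lemma integrable_normal_sqr : N.-integrable setT (EFin \o (fun x : R => x ^+ 2)).
Proof.
apply/integrableP; split; first exact/measurable_EFinP.
under eq_integral do rewrite /= ger0_norm ?sqr_ge0//.
exact: le_lt_trans normal_second_moment (ltry _).
Qed.

Lemma integrable_normal_abs : N.-integrable setT (EFin \o (fun x : R => `|x|)).
Proof.
apply: (@integrable_dominated _ _ R N (fun x => `|x|) (fun x : R => 1 + x ^+ 2)) => //.
- exact: normr_measurable.
- have i1 : N.-integrable setT (EFin \o cst (1 : R)) by exact: finite_measure_integrable_cst.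
  have := integrableD measurableT i1 integrable_normal_sqr.
  exact: eq_integrable.
- move=> x; rewrite normr_id -real_normK ?num_real//.
  by have := sqr_ge0 (`|x| - 1); have := normr_ge0 x; nra.
Qed.

Lemma integrable_normal_id : N.-integrable setT (EFin \o (fun x : R => x)).
Proof. by apply: integrable_dominated integrable_normal_abs _. Qed.

(** Reflection exchanges the positive and the negative part of the identity. *)
Lemma normal_mean0 : (\int[N]_x (x%:E) = 0 :> \bar R)%E.
Proof.
rewrite integralE.
rewrite -(@ge0_integral_normalN (fun x => (EFin^\- x)%E))//; last first.
  exact: measurable_funeneg.
rewrite (_ : (fun x : R => (EFin^\- (- x)%R)%E) = (EFin^\+)%E); last first.
  by apply/funext => x; rewrite funeposE funenegE EFinN oppeK.
rewrite subee//.
have := integrable_funepos measurableT integrable_normal_id.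
by move=> /(integrable_fin_num measurableT).
Qed.

End normal01.

(** * Smoothing by Gaussian noise on the line *)

Section heat.
Context (R : realType).
Notation mu := (@lebesgue_measure R).
Notation N := (normal_prob (0 : R) 1).
Notation phi := (normal_pdf (0 : R) 1).

(** The translation moves from F, which is only measurable, to the smooth
    Gaussian density, where it can be differentiated. *)
Lemma integral_normal_translate (p F : R -> R) (z : R) :
  measurable_fun setT p -> measurable_fun setT F ->
  (\int[N]_x (p x * F (x + z)%R)%:E =
   \int[mu]_u (F u * (p (u - z)%R * phi (u - z)%R))%:E)%E.
Proof.
move=> mp mF; have mFz : measurable_fun setT (fun x : R => F (x + z)).
  by apply: measurableT_comp => //; exact: measurable_funD.
rewrite integral_normal; last by apply/measurable_EFinP; exact: measurable_funM.
rewrite -[RHS](@integral_shift R z); last first.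
  apply/measurable_EFinP; apply: measurable_funM => //.
  apply: measurable_funM; (apply: measurableT_comp; last exact: measurable_funD) => //.
  exact: measurable_normal_pdf.
by apply: eq_integral => x _; rewrite addrK -EFinM; congr EFin; ring.
Qed.

Lemma is_derive_normal_pdf (x : R) : is_derive x 1 phi (- (x * phi x)).
Proof.
have -> : phi = (fun y => phi 0 * expR (- y ^+ 2 / 2)).
  by apply/funext => y; rewrite normal_pdf1E.
have dg := is_derive_gauss (2 : R) x.
by apply: is_derive_eq; rewrite /GRing.scale/=; field.
Qed.

Lemma integral_derive_normal_pdf (u r y : R) : 0 <= y ->
  (\int[mu]_(v in `[0%R, y]) (r * ((u - r * v) * phi (u - r * v)))%:E
   = (phi (u - r * y) - phi u)%:E)%E.
Proof.
rewrite le_eqVlt => /predU1P[<-|y0].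
  by rewrite set_itv1 integral_set1 mulr0 subr0 subrr.
pose F (v : R) := phi (u - r * v).
have dF (v : R) : is_derive v 1 F (r * ((u - r * v) * phi (u - r * v))).
  have dphi := is_derive_normal_pdf (u - r * v).
  have dg : is_derive v 1 (fun w : R => u - r * w) (- r).
    by apply: is_derive_eq; rewrite /GRing.scale/=; ring.
  rewrite (_ : r * _ = - ((u - r * v) * phi (u - r * v)) * - r); last by ring.
  exact: (@is_derive1_comp R phi (fun w => u - r * w) v _ _ dphi dg).
have cF : continuous F.
  move=> v; apply/differentiable_continuous/derivable1_diffP.
  exact: (@ex_derive _ _ _ _ _ _ _ (dF v)).
rewrite (@continuous_FTC2 R _ F)//.
- by rewrite /F mulr0 subr0 EFinB.
- apply: continuous_subspaceT => v; apply: cvgM; first exact: cvg_cst.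
  apply: cvgM; last exact: cF.
  apply: cvgB; first exact: cvg_cst.
  by apply: cvgM; [exact: cvg_cst|exact: cvg_id].
- split; [by move=> v _; exact: (@ex_derive _ _ _ _ _ _ _ (dF v))| |].
  + exact/cvg_at_right_filter/cF.
  + exact/cvg_at_left_filter/cF.
- by move=> v _; rewrite derive1E; exact: (@derive_val _ _ _ _ _ _ _ (dF v)).
Qed.

Lemma normal_pdf_translate (z u : R) : normal_pdf z 1 u = phi (u - z).
Proof.
by rewrite !normal_pdfE ?oner_neq0//= normal_fun_center.
Qed.

Section increment.
Variables (F : R -> R) (r : R).
Hypothesis mF : measurable_fun setT F.
Hypothesis F1 : forall u, `|F u| <= 1.

(** Up to the rescaling that turns F into f (s x) and r into a / s, this is
    E f (a y + s X) with X standard Gaussian. *)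
Definition heat1 (y : R) : R := \int[N]_x F (x + r * y).

(** The first Hermite coefficient of x |-> F (x + r y); multiplied by r it is
    the derivative of heat1 at y. *)
Definition heat1_score (y : R) : R := \int[N]_x (x * F (x + r * y)).

Let mFz (z : R) : measurable_fun setT (fun x : R => F (x + z)).
Proof. by apply: measurableT_comp => //; exact: measurable_funD. Qed.

Let iF (z : R) : mu.-integrable setT (EFin \o (fun u : R => F u * phi (u - z))).
Proof.
apply: (@integrable_dominated _ _ R mu _ (normal_pdf z 1)).
- apply: measurable_funM => //; apply: measurableT_comp; last exact: measurable_funD.
  exact: measurable_normal_pdf.
- exact: integrable_normal_pdf.
- move=> u; rewrite normrM (normal_pdf_translate z) (ger0_norm (normal_pdf_ge0 _ _ _)).
  by rewrite -[leRHS]mul1r ler_wpM2r// normal_pdf_ge0.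
Qed.

Let hE y : (heat1 y)%:E = (\int[mu]_u (F u * phi (u - r * y)%R)%:E)%E.
Proof.
rewrite EFin_Rintegral//; last first.
  by apply: (@integrable_dominated _ _ R N _ (cst 1)) => //;
    [exact: mFz|exact: finite_measure_integrable_cst].
transitivity (\int[N]_x ((cst 1 x) * F (x + r * y)%R)%:E)%E.
  by apply: eq_integral => x _; rewrite /= mul1r.
rewrite integral_normal_translate//.
by apply: eq_integral => x _; rewrite /= mul1r.
Qed.

(** The v-derivative of F u * phi (u - r v); its u-integral is r times the
    score at v. *)
Let K (vu : R * R) : R := F vu.2 * (r * (vu.2 - r * vu.1) * phi (vu.2 - r * vu.1)).

Let rbE v : (r * heat1_score v)%:E = (\int[mu]_u (K (v, u))%:E)%E.
Proof.
rewrite -RintegralZl//; last first.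
  apply: (@integrable_dominated _ _ R N _ (fun x : R => `|x|)) => //.
  - by apply: measurable_funM => //; exact: mFz.
  - exact: integrable_normal_abs.
  - by move=> x; rewrite normrM ler_piMr.
rewrite EFin_Rintegral//; last first.
  apply: (@integrable_dominated _ _ R N _ (fun x : R => `|r| * `|x|)) => //.
  - by do 2 apply: measurable_funM => //; exact: mFz.
  - exact: (integrableZl measurableT `|r| (integrable_normal_abs R)).
  - by move=> x; rewrite !normrM ler_wpM2l// ler_piMr.
under eq_integral do rewrite mulrA.
by rewrite (@integral_normal_translate (fun x => r * x) F (r * v))//; exact: measurable_funM.
Qed.

Let mK : measurable_fun setT K.
Proof.
rewrite /K; have m1 : measurable_fun setT (fun vu : R * R => vu.2 - r * vu.1).
  apply: measurable_funB => //; exact: measurable_funM.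
apply: measurable_funM; first exact: measurableT_comp.
apply: measurable_funM; first exact: measurable_funM.
by apply: measurableT_comp => //; exact: measurable_normal_pdf.
Qed.

Let iK y : (mu \x mu)%E.-integrable setT
  (EFin \o (fun vu : R * R => \1_(`[0, y]%classic) vu.1 * K vu)).
Proof.
have mI : measurable_fun setT (fun vu : R * R => \1_(`[0, y]%classic) vu.1 * K vu).
  by apply: measurable_funM => //; apply: measurableT_comp.
apply/integrable12ltyP; first exact/measurable_EFinP.
pose A := \int[N]_x `|x|.
apply: (@le_lt_trans _ _ (\int[mu]_v (\1_(`[0, y]%classic) v * (`|r| * A))%:E)%E).
  apply: ge0_le_integral => //.
  - by move=> v _; exact: integral_ge0.
  - apply: (measurable_fun_fubini_tonelli_F (m2 := mu)
      (abse \o (EFin \o (fun vu : R * R => \1_(`[0, y]%classic) vu.1 * K vu)))) => //=.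
    by apply: measurableT_comp => //; exact/measurable_EFinP.
  - by apply/measurable_EFinP; apply: measurable_funM.
  move=> v _ /=.
  have mp : measurable_fun setT (fun u : R => `|u - r * v| * phi (u - r * v)).
    have m1 : measurable_fun setT (fun u : R => u - r * v) by exact: measurable_funB.
    apply: measurable_funM; first exact: measurableT_comp.
    by apply: measurableT_comp => //; exact: measurable_normal_pdf.
  rewrite mulrA EFinM.
  have -> : A%:E = (\int[mu]_u (`|u - (r * v)%R| * phi (u - (r * v)%R))%:E)%E.
    rewrite EFin_Rintegral//; last exact: integrable_normal_abs.
    transitivity (\int[N]_x (`|x| * cst 1 (x + r * v)%R)%:E)%E.
      by apply: eq_integral => x _; rewrite /= mulr1.
    rewrite integral_normal_translate//.
    by apply: eq_integral => x _; rewrite /= mul1r.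
  rewrite -ge0_integralZl//; last 2 first.
  - exact/measurable_EFinP.
  - by move=> u _; rewrite lee_fin mulr_ge0 ?normr_ge0 ?normal_pdf_ge0.
  apply: ge0_le_integral => //.
  - have mv : measurable_fun setT (fun u : R => \1_(`[0, y]%classic) v * K (v, u)).
      exact: (measurableT_comp mI (pair1_measurable v)).
    apply/measurable_EFinP; exact: (measurableT_comp (@normr_measurable R setT) mv).
  - by apply: measurable_funeM; exact/measurable_EFinP.
  move=> u _ /=; rewrite lee_fin /K/= !normrM.
  rewrite (ger0_norm (normal_pdf_ge0 _ _ _)) (ger0_norm (_ : 0 <= \1_ _ v))//.
  rewrite [leRHS](_ : _ = \1_(`[0, y]%classic) v
    * (1 * (`|r| * `|u - r * v| * phi (u - r * v)))); last by ring.
  by rewrite ler_wpM2l// ler_wpM2r// !mulr_ge0// normal_pdf_ge0.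
under eq_integral do rewrite EFinM.
rewrite ge0_integralZr//; last 2 first.
- exact/measurable_EFinP.
- by rewrite lee_fin mulr_ge0//; apply: Rintegral_ge0.
rewrite integral_indic//= setIT lebesgue_measure_itv/= -EFinB.
by case: ifP => _; rewrite -?EFinM ?mul0e ltry.
Qed.

(** Integrating the v-derivative of the kernel over [0, y] and exchanging the
    two integrals replaces differentiation under the integral sign. *)
Lemma heat_increment y : 0 <= y ->
  (\int[mu]_(v in `[0%R, y]) (r * heat1_score v)%:E = (heat1 y - heat1 0)%:E)%E.
Proof.
move=> y0.
transitivity (\int[mu]_v \int[mu]_u (\1_(`[0, y]%classic) v * K (v, u))%:E)%E.
  rewrite integral_mkcond; apply: eq_integral => v _.
  rewrite patchE; case: ifPn => vy.
    by rewrite rbE indicE vy; apply: eq_integral => u _; rewrite mul1r.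
  rewrite indicE (negbTE vy); under eq_integral do rewrite mul0r.
  by rewrite integral0.
rewrite (Fubini (iK y)) EFinB !hE mulr0 -integralB_EFin//.
apply: eq_integral => u _; rewrite subr0.
transitivity ((F u)%:E * \int[mu]_(v in `[0%R, y]) (r * ((u - r * v) * phi (u - r * v)))%:E)%E.
  rewrite -integralZl//; last first.
    apply: continuous_compact_integrable; first exact: segment_compact.
    apply: continuous_subspaceT => v.
    have cl : {for v, continuous (fun v : R => u - r * v)}.
      apply: cvgB; first exact: cvg_cst.
      by apply: cvgM; [exact: cvg_cst|exact: cvg_id].
    apply: cvgM; first exact: cvg_cst.
    apply: cvgM; first exact: cl.
    apply: (cvg_comp (fun v : R => u - r * v) phi); first exact: cl.
    by apply: continuous_normal_pdf; exact: oner_neq0.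
  rewrite [RHS]integral_mkcond; apply: eq_integral => v _.
  rewrite [RHS]patchE /= indicE; case: ifPn => vy; last by rewrite mul0r.
  by rewrite mul1r /K/= -EFinM !mulrA.
by rewrite integral_derive_normal_pdf// -EFinM -EFinB mulrBr.
Qed.

End increment.

End heat.

(** * A Hardy inequality on the half-line *)

Section hardy.
Context (R : realType).
Notation mu := (@lebesgue_measure R).
Notation phi := (normal_pdf (0 : R) 1).

Lemma bounded_integrable_itv (f : R -> R) (K y : R) : measurable_fun setT f ->
  (forall v, `|f v| <= K) -> mu.-integrable `[0, y] (EFin \o f).
Proof.
move=> mf fK; apply: measurable_bounded_integrable => //.
- by rewrite /= lebesgue_measure_itv/=; case: ifP => _; rewrite -?EFinB ltry.
- exact: measurable_funTS.
- exists K; split; first exact: num_real.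
  by move=> x Kx v _; exact: le_trans (fK v) (ltW Kx).
Qed.

Section half.
Variables (B u : R -> R) (C : R).
Hypothesis mB : measurable_fun setT B.
Hypothesis measurable_u : measurable_fun setT u.
Hypothesis BC : forall v, `|B v| <= C.
Hypothesis uB : forall y, 0 <= y -> `|u y| <= \int[mu]_(v in `[0, y]) `|B v|.

Let w (v : R) := expR (- v ^+ 2 / 4).

Let mw : measurable_fun setT w.
Proof. exact: measurable_gauss. Qed.

Let w01 v : 0 < w v <= 1.
Proof.
rewrite expR_gt0/= /w -[leRHS]expR0 ler_expR mulNr oppr_le0.
by rewrite divr_ge0 ?sqr_ge0.
Qed.

Let C0 : 0 <= C.
Proof. exact: le_trans (normr_ge0 _) (BC 0). Qed.

Let BwC v : `|B v ^+ 2 * w v| <= C ^+ 2.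
Proof.
have /andP[w0 w1] := w01 v.
rewrite normrM normrX (ger0_norm (ltW w0)).
by rewrite -[leRHS]mulr1 ler_pM// ?exprn_ge0 ?(ltW w0)// lerXn2r// nnegrE.
Qed.

Let mBw : measurable_fun setT (fun v => B v ^+ 2 * w v).
Proof. by apply: measurable_funM => //; exact: measurable_funX. Qed.

Let iQ y : mu.-integrable `[0, y] (EFin \o (fun v => B v ^+ 2 * w v)).
Proof. exact: (@bounded_integrable_itv _ (C ^+ 2)). Qed.

(** Cauchy-Schwarz on [0, y] for the product of |B v| sqrt (w v) and
    1 / sqrt (w v), with the integral of 1 / w bounded by y / w y. *)
Let cs y : 0 <= y ->
  (u y) ^+ 2 * w y <= y * \int[mu]_(v in `[0, y]) (B v ^+ 2 * w v).
Proof.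
rewrite le_eqVlt => /predU1P[<-|y0].
  have := @uB 0 (lexx _); rewrite set_itv1 Rintegral_set1 normr_le0 => /eqP ->.
  by rewrite expr0n/= !mul0r.
set Q := \int[mu]_(v in _) _; set A := \int[mu]_(v in `[0, y]) `|B v|.
have uA := uB (ltW y0); rewrite -/A in uA.
have iB : mu.-integrable `[0, y] (EFin \o (fun v => `|B v|)).
  apply: (@bounded_integrable_itv _ C); first exact: measurableT_comp.
  by move=> v; rewrite normr_id.
have iQy := iQ y.
(* The integral over [0, y] of 2 l |B v| <= l^2 / w v + B v^2 w v, which is
   (l - |B v| w v)^2 >= 0 divided by w v. *)
have main l : 2 * l * A <= l ^+ 2 * (w y)^-1 * y + Q.
  have -> : l ^+ 2 * (w y)^-1 * y = \int[mu]_(v in `[0, y]) cst (l ^+ 2 * (w y)^-1) v.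
    by rewrite Rintegral_cst//= lebesgue_measure_itv/= lte_fin y0/= oppr0 addr0.
  rewrite -RintegralZl// -RintegralD//; last 1 first.
    by apply: (@bounded_integrable_itv _ `|l ^+ 2 * (w y)^-1|).
  apply: le_Rintegral => //.
  - by apply: (integrableZl _ (2 * l) iB).
  - apply: (@bounded_integrable_itv _ (`|l ^+ 2 * (w y)^-1| + C ^+ 2)).
      by apply: measurable_funD.
    by move=> v; apply: le_trans (ler_normD _ _) _; rewrite lerD2l.
  move=> v /=; rewrite in_itv/= => /andP[v0 vy].
  have /andP[w0 _] := w01 v; have /andP[wy0 _] := w01 y.
  have wvy : (w v)^-1 <= (w y)^-1.
    rewrite lef_pV2 ?posrE// ler_expR !mulNr lerN2 ler_pM2r ?invr_gt0//.
    by rewrite lerXn2r// nnegrE// ltW.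
  apply: (@le_trans _ _ (l ^+ 2 * (w v)^-1 + B v ^+ 2 * w v)); last first.
    by rewrite lerD2r ler_wpM2l// sqr_ge0.
  have W1 : w v * (w v)^-1 = 1 by rewrite mulfV// gt_eqF.
  have : 0 <= (l - `|B v| * w v) ^+ 2 * (w v)^-1.
    by rewrite mulr_ge0 ?sqr_ge0// invr_ge0 ltW.
  rewrite -[B v ^+ 2]real_normK ?num_real//.
  rewrite (_ : _ * (w v)^-1 = l ^+ 2 * (w v)^-1 - 2 * l * `|B v| * (w v * (w v)^-1)
    + `|B v| ^+ 2 * w v * (w v * (w v)^-1)); last by ring.
  by rewrite W1; lra.
have /andP[wy0 _] := w01 y.
(* this l maximizes 2 l A - l^2 y / w y *)
have := main (A * w y / y).
rewrite (_ : (A * w y / y) ^+ 2 * (w y)^-1 * y = A ^+ 2 * w y / y); last first.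
  by field; rewrite !gt_eqF.
rewrite (_ : 2 * _ * A = 2 * (A ^+ 2 * w y / y)); last by ring.
move=> le1; have le2 : A ^+ 2 * w y / y <= Q by lra.
rewrite ler_pdivrMr// in le2.
rewrite [leRHS]mulrC; apply: le_trans le2.
rewrite ler_pM2r// (_ : u y ^+ 2 = `|u y| ^+ 2); last by rewrite real_normK ?num_real.
by rewrite lerXn2r ?nnegrE ?(le_trans (normr_ge0 (u y)) uA).
Qed.

(** G (y, v), restricted to 0 <= v <= y, has as v-integral the upper bound that
    cs gives for u y ^+ 2 * phi y (as phi = phi 0 * w^2), and an explicit
    y-integral (gauss_tail). *)
Let T := [set p : R * R | 0 <= p.2] `&` [set p | p.2 <= p.1].

Let mT : measurable (T : set (measurableTypeR R * measurableTypeR R)).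
Proof. by apply: measurableI; exact: measurable_le_set. Qed.

Let G (yv : R * R) : R := \1_T yv *
  (phi 0 * (yv.1 * w yv.1) * (B yv.2 ^+ 2 * w yv.2)).

Let mG : measurable_fun setT (G : measurableTypeR R * measurableTypeR R -> R).
Proof.
have m1 : measurable_fun setT (fun v : R => v * w v) by exact: measurable_funM.
have m2 : measurable_fun setT (fun v : R => B v ^+ 2 * w v).
  by apply: measurable_funM => //; exact: measurable_funX.
apply: measurable_funM; first exact: measurable_indic.
apply: measurable_funM; last exact: (measurableT_comp m2 measurable_snd).
apply: measurable_funM; first exact: measurable_cst.
exact: (measurableT_comp m1 measurable_fst).
Qed.

Let G0 yv : 0 <= G yv.
Proof.
have /andP[w1 _] := w01 yv.1; have /andP[w2 _] := w01 yv.2.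
rewrite /G indicE; case: (boolP (yv \in T)) => [|_]; last by rewrite mul0r.
rewrite inE => -[/= v0 vy]; rewrite mul1r.
apply: mulr_ge0; apply: mulr_ge0; rewrite ?sqr_ge0 ?normal_pdf_ge0//; last exact: ltW.
by apply: mulr_ge0; [exact: le_trans vy|exact: ltW].
Qed.

Let integral_Gv y : 0 <= y ->
  (\int[mu]_v (G (y, v))%:E = (phi 0 * (y * w y))%:E *
     (\int[mu]_(v in `[0%R, y]) (B v ^+ 2 * w v)%:E))%E.
Proof.
move=> y0; have /andP[wy _] := w01 y.
rewrite -ge0_integralZl//; last 3 first.
- by apply/measurable_EFinP; exact: measurable_funTS.
- by move=> v _; rewrite lee_fin mulr_ge0 ?sqr_ge0// expR_ge0.
- by rewrite lee_fin !mulr_ge0 ?normal_pdf_ge0// ltW.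
rewrite [RHS]integral_mkcond; apply: eq_integral => v _.
rewrite patchE /G indicE.
have -> : ((y, v) \in T) = (v \in `[0, y]%classic).
  apply/idP/idP; rewrite !inE/= in_itv/=; first by move=> [a b]; apply/andP.
  by move=> /andP[a b].
by case: ifPn => _; rewrite ?mul0r// mul1r.
Qed.

Let integral_Gy v : 0 <= v ->
  (\int[mu]_y (G (y, v))%:E = (phi 0 * (B v ^+ 2 * w v))%:E *
     (\int[mu]_(y in `[v, +oo[) (y * w y)%:E))%E.
Proof.
move=> v0; have /andP[wv _] := w01 v.
have m1 : measurable_fun setT (fun v : R => v * w v) by exact: measurable_funM.
rewrite -ge0_integralZl//; last 3 first.
- by apply/measurable_EFinP; exact: measurable_funTS.
- move=> y /=; rewrite in_itv/= andbT => vy.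
  by rewrite lee_fin; apply: mulr_ge0; [exact: le_trans vy|exact: expR_ge0].
- rewrite lee_fin; apply: mulr_ge0; first exact: normal_pdf_ge0.
  by apply: mulr_ge0; [exact: sqr_ge0|exact: ltW].
rewrite [RHS]integral_mkcond; apply: eq_integral => y _.
rewrite patchE /G indicE.
have -> : ((y, v) \in T) = (y \in `[v, +oo[%classic).
  apply/idP/idP; rewrite !inE/= in_itv/= andbT; first by case.
  by move=> vy; split.
by case: ifPn => _; rewrite ?mul0r// mul1r -EFinM/=; congr EFin; ring.
Qed.

(** The Cauchy-Schwarz bound for u^2 is integrated against phi = phi 0 * w^2.
    After exchanging the integrals, the inner one is the tail of y w y beyond v,
    equal to 2 w v, and the three weights recombine to 2 phi v. *)
Lemma hardy_half :
  (\int[mu]_(y in `[0%R, +oo[) ((u y ^+ 2)%:E * (phi y)%:E) <=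
   \int[mu]_(v in `[0%R, +oo[) ((2 * B v ^+ 2)%:E * (phi v)%:E))%E.
Proof.
have ww v : phi v = phi 0 * w v * w v.
  by rewrite [LHS]normal_pdf1E -mulrA -expRD; congr (_ * expR _); field.
have mphi : measurable_fun setT phi by exact: measurable_normal_pdf.
have mGE : measurable_fun setT 
    ((fun p => (G p)%:E) : measurableTypeR R * measurableTypeR R -> \bar R).
  exact/measurable_EFinP.
have GE0 (p : R * R) : (0 <= (G p)%:E)%E by rewrite lee_fin.
apply: (@le_trans _ _ (\int[mu]_y \int[mu]_v (G (y, v))%:E)%E).
  rewrite integral_mkcond; apply: ge0_le_integral => //.
  - move=> y _; apply: erestrict_ge0 => x _.
    by rewrite -EFinM lee_fin mulr_ge0 ?sqr_ge0 ?normal_pdf_ge0.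
  - apply/(measurable_restrictT _ _).1 => //; apply: measurable_funTS.
    by apply/measurable_EFinP; apply: measurable_funM => //; exact: measurable_funX.
  - exact: (measurable_fun_fubini_tonelli_F (m2 := mu) _ mGE).
  move=> y _; rewrite patchE; case: ifPn => [|_]; last exact: integral_ge0.
  rewrite inE/= in_itv/= andbT => y0.
  rewrite integral_Gv// -(EFin_Rintegral _ (iQ y))// -!EFinM lee_fin.
  have /andP[wy _] := w01 y.
  rewrite (ww y) [leLHS](_ : _ = phi 0 * w y * (u y ^+ 2 * w y)); last by ring.
  rewrite [leRHS](_ : _ = phi 0 * w y
    * (y * \int[mu]_(v in `[0, y]) (B v ^+ 2 * w v))); last by ring.
  by apply: ler_wpM2l (cs y0); rewrite mulr_ge0 ?normal_pdf_ge0// ltW.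
have -> := fubini_tonelli (m1 := mu) (m2 := mu) _ mGE GE0.
rewrite [leRHS]integral_mkcond; apply: ge0_le_integral => //.
- by move=> v _; exact: integral_ge0.
- exact: (measurable_fun_fubini_tonelli_G (m1 := mu) _ mGE).
- apply/(measurable_restrictT _ _).1 => //; apply: measurable_funTS.
  apply/measurable_EFinP; apply: measurable_funM => //.
  by apply: measurable_funM => //; exact: measurable_funX.
move=> v _; rewrite patchE; case: ifPn => [|v0]; last first.
  rewrite integral0_eq// => y _; rewrite /G indicE.
  case: (boolP (_ \in T)) => [|_]; last by rewrite mul0r.
  by rewrite inE => -[/= v0' _]; move: v0; rewrite notin_setE/= in_itv/= v0'.
rewrite inE/= in_itv/= andbT => v0.
rewrite integral_Gy// gauss_tail// -!EFinM lee_fin (ww v) (_ : expR (- v ^+ 2 / 4) = w v)//.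
by rewrite le_eqVlt; apply/orP; left; apply/eqP; ring.
Qed.

End half.
End hardy.

(** * A Poincare inequality on the line *)

Section poincare1.
Context (R : realType).
Notation mu := (@lebesgue_measure R).
Notation N := (normal_prob (0 : R) 1).
Notation phi := (normal_pdf (0 : R) 1).

Section halves.
Variables (F : R -> R) (r : R).
Hypothesis mF : measurable_fun setT F.
Hypothesis F1 : forall u, `|F u| <= 1.

Let mFxy : measurable_fun setT (fun xy : R * R => F (xy.1 + r * xy.2)).
Proof.
apply: measurableT_comp => //; apply: measurable_funD => //.
exact: measurable_funM.
Qed.

Let ic1 : N.-integrable setT (EFin \o cst (1 : R)).
Proof. exact: finite_measure_integrable_cst. Qed.

Lemma measurable_heat1 : measurable_fun setT (heat1 F r).
Proof.
by apply: (@dominated_measurable2 _ _ _ _ R N N _ (cst 1) (cst 1) mFxy) => // x y; rewrite /= mulr1.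
Qed.

Lemma heat1_le1 y : `|heat1 F r y| <= 1.
Proof.
by apply: bounded_Rintegral => //; exact: measurableT_comp mFxy (pair2_measurable y).
Qed.

Let mxFxy : measurable_fun setT (fun xy : R * R => xy.1 * F (xy.1 + r * xy.2)).
Proof. exact: measurable_funM. Qed.

Let xF_le (x y : R) : `|x * F (x + r * y)| <= `|x| * cst 1 y.
Proof. by rewrite normrM ler_wpM2l. Qed.

Lemma measurable_heat1_score : measurable_fun setT (heat1_score F r).
Proof.
exact: (@dominated_measurable2 _ _ _ _ R N N _ (fun x => `|x|) (cst 1) mxFxy
  (integrable_normal_abs R) ic1 xF_le).
Qed.

Lemma heat1_score_le y : `|heat1_score F r y| <= \int[N]_x `|x|.
Proof.
have := @dominated_le2 _ _ _ _ R N _ (fun x => `|x|) (cst 1) mxFxy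
  (integrable_normal_abs R) xF_le y.
by rewrite /= mulr1.
Qed.

(** By heat_increment, the deviation from the value at 0 is dominated by the
    integral of the absolute scores, as hardy_half requires. *)
Lemma heat1_half :
  (\int[mu]_(y in `[0%R, +oo[) (((heat1 F r y - heat1 F r 0) ^+ 2)%:E * (phi y)%:E) <=
   \int[mu]_(v in `[0%R, +oo[) ((2 * (r * heat1_score F r v) ^+ 2)%:E * (phi v)%:E))%E.
Proof.
have mb : measurable_fun setT (fun y => r * heat1_score F r y).
  by apply: measurable_funM => //; exact: measurable_heat1_score.
have bC v : `|r * heat1_score F r v| <= `|r| * \int[N]_x `|x|.
  by rewrite normrM ler_wpM2l// heat1_score_le.
apply: (hardy_half mb _ bC); first by apply: measurable_funB => //; exact: measurable_heat1.
move=> y y0.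
have ib : mu.-integrable `[0, y] (EFin \o (fun y => r * heat1_score F r y)).
  exact: bounded_integrable_itv mb bC.
have /= := heat_increment r mF F1 y0.
rewrite -(EFin_Rintegral _ ib)// => -[] <-.
exact: le_normr_Rintegral.
Qed.

End halves.

Lemma heat1N (F : R -> R) (r y : R) : heat1 F (- r) y = heat1 F r (- y).
Proof. by rewrite /heat1 mulNr mulrN. Qed.

Lemma heat1_scoreN (F : R -> R) (r y : R) :
  heat1_score F (- r) y = heat1_score F r (- y).
Proof. by rewrite /heat1_score mulNr mulrN. Qed.

(** The variance is at most the second moment about heat1 F r 0, which is split
    at 0; y |-> - y turns the negative half-line into the positive one for - r. *)
Lemma poincare_heat1 (F : R -> R) (r : R) : measurable_fun setT F ->
  (forall u, `|F u| <= 1) ->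
  \int[N]_y (heat1 F r y ^+ 2) - (\int[N]_y heat1 F r y) ^+ 2
  <= 2 * r ^+ 2 * \int[N]_y (heat1_score F r y ^+ 2).
Proof.
move=> mF F1.
have mh := measurable_heat1 r mF F1; have hC := heat1_le1 r mF F1.
have mb := measurable_heat1_score r mF F1; have bC := heat1_score_le r mF F1.
apply: (le_trans (variance_le_center N (heat1 F r 0) mh hC)).
have mu2 : measurable_fun setT (fun y => (heat1 F r y - heat1 F r 0) ^+ 2).
  by apply: measurable_funX; exact: measurable_funB.
have mb2 : measurable_fun setT (fun y => heat1_score F r y ^+ 2) by exact: measurable_funX.
have ib2 : N.-integrable setT (EFin \o (fun y => heat1_score F r y ^+ 2)).
  apply: (@bounded_integrable _ _ _ _ _ ((\int[N]_x `|x|) ^+ 2)) => //.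
  by move=> x; rewrite normrX lerXn2r// nnegrE// (le_trans _ (bC x)).
rewrite -RintegralZl// -lee_fin !EFin_Rintegral//; last 2 first.
- exact: (integrableZl measurableT (2 * r ^+ 2) ib2).
- apply: (@bounded_integrable _ _ _ _ _ ((1 + 1) ^+ 2)) => //.
  move=> x; rewrite normrX lerXn2r// ?nnegrE//.
  by rewrite (le_trans (ler_normB _ _))// lerD.
rewrite !ge0_integral_normal_halves//; last 4 first.
- move=> x; rewrite lee_fin; apply: mulr_ge0; last exact: sqr_ge0.
  by apply: mulr_ge0 => //; exact: sqr_ge0.
- by apply/measurable_EFinP; exact: measurable_funM.
- by move=> x; rewrite lee_fin sqr_ge0.
- exact/measurable_EFinP.
apply: leeD.
  apply: le_trans (heat1_half r mF F1) _.
  rewrite le_eqVlt; apply/orP; left; apply/eqP; apply: eq_integral => v _.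
  by congr (_%:E * _)%E; ring.
have := heat1_half (- r) mF F1.
under eq_integral do rewrite !heat1N oppr0.
move/le_trans; apply.
rewrite le_eqVlt; apply/orP; left; apply/eqP; apply: eq_integral => v _.
by rewrite heat1_scoreN; congr (_%:E * _)%E; ring.
Qed.

End poincare1.

(** * The Gaussian measure on n-tuples *)

Section gaussian_recursion.
Context (R : realType).
Notation N := (normal_prob (0 : R) 1).

Lemma measurable_Rn_cons_comp n (G : Rn R n.+1 -> R) : measurable_fun setT G ->
  measurable_fun setT (G \o @Rn_cons R n).
Proof. by move=> mG; apply: measurableT_comp => //; exact: measurable_Rn_cons. Qed.

Lemma ge0_integral_gaussianS n (G : Rn R n.+1 -> \bar R) : measurable_fun setT G ->
  (forall z, 0 <= G z)%E ->
  (\int[gaussian R n.+1]_z G z = \int[gaussian R n]_y \int[N]_x G (Rn_cons (x, y)))%E.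
Proof.
move=> mG G0; rewrite [LHS]ge0_integral_distribution//.
rewrite (fubini_tonelli2 (m1 := N) (m2 := gaussian R n) (G \o @Rn_cons R n))//.
- by apply: measurableT_comp => //; exact: measurable_Rn_cons.
- by move=> p /=.
Qed.

Lemma Rintegral_gaussianS n (G : Rn R n.+1 -> R) : measurable_fun setT G ->
  (N \x gaussian R n)%E.-integrable setT (EFin \o (G \o @Rn_cons R n)) ->
  \int[gaussian R n.+1]_z G z = \int[(N \x gaussian R n)%E]_p G (Rn_cons p).
Proof.
move=> mG iG; rewrite /Rintegral; congr fine.
by rewrite [LHS]integral_distribution//; exact/measurable_EFinP.
Qed.

Lemma bounded_Rintegral_gaussianS n (G : Rn R n.+1 -> R) (C : R) :
  measurable_fun setT G -> (forall z, `|G z| <= C) ->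
  \int[gaussian R n.+1]_z G z = \int[N]_x \int[gaussian R n]_y G (Rn_cons (x, y)).
Proof.
move=> mG GC; have mGc := measurable_Rn_cons_comp mG.
have iC : N.-integrable setT (EFin \o cst C) by exact: finite_measure_integrable_cst.
have i1 : (gaussian R n).-integrable setT (EFin \o cst (1 : R)).
  exact: finite_measure_integrable_cst.
have dom x y : `|(G \o @Rn_cons R n) (x, y)| <= cst C x * cst 1 y by rewrite /= mulr1.
rewrite Rintegral_gaussianS//; last exact: dominated_integrable_prod mGc iC i1 dom.
exact: dominated_fubini1 mGc iC i1 dom.
Qed.

Lemma tnth_Rn_cons0 n (p : R * Rn R n) : tnth (Rn_cons p) ord0 = p.1.
Proof. by rewrite /Rn_cons (tnth_nth 0). Qed.

Lemma tnth_Rn_consS n (p : R * Rn R n) i : tnth (Rn_cons p) (lift ord0 i) = tnth p.2 i.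
Proof. by rewrite /Rn_cons tnthS. Qed.

Lemma lincomb_Rn_cons n (a s : R) (q p : R * Rn R n) :
  lincomb a (Rn_cons q) s (Rn_cons p)
  = Rn_cons (a * q.1 + s * p.1, lincomb a q.2 s p.2).
Proof.
apply: eq_from_tnth => i; rewrite tnth_mktuple.
case: (unliftP ord0 i) => [j ->|->].
  by rewrite !tnth_Rn_consS/= tnth_mktuple.
by rewrite !tnth_Rn_cons0.
Qed.

Lemma measurable_lincomb n (a s : R) :
  measurable_fun setT (fun yx : Rn R n * Rn R n => lincomb a yx.1 s yx.2).
Proof.
apply/measurable_fun_tnthP => i.
rewrite (_ : _ \o _ = fun yx : Rn R n * Rn R n => a * tnth yx.1 i + s * tnth yx.2 i); last first.
  by apply/funext => yx /=; rewrite tnth_mktuple.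
apply: measurable_funD; apply: measurable_funM => //.
- exact: (measurableT_comp (measurable_tnth i) measurable_fst).
- exact: (measurableT_comp (measurable_tnth i) measurable_snd).
Qed.

(** The marginals of the Gaussian measure are standard normal. *)
Lemma ge0_integral_gaussian_tnth n (i : 'I_n) (G : R -> \bar R) :
  measurable_fun setT G -> (forall x, 0 <= G x)%E ->
  (\int[gaussian R n]_x G (tnth x i) = \int[N]_u G u)%E.
Proof.
move=> mG G0; elim: n i => [[]//|n IH] i.
rewrite ge0_integral_gaussianS//; last first.
  by apply: measurableT_comp => //; exact: measurable_tnth.
case: (unliftP ord0 i) => [j ->|->].
  rewrite -(IH j); apply: eq_integral => y _.
  rewrite -[RHS](integral_prob_cst N); apply: eq_integral => x _.
  by rewrite tnth_Rn_consS.
rewrite -[RHS](integral_prob_cst (gaussian R n)); apply: eq_integral => y _.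
by apply: eq_integral => x _; rewrite tnth_Rn_cons0.
Qed.

Lemma integrable_gaussian_tnth n (i : 'I_n) :
  (gaussian R n).-integrable setT (EFin \o (fun x : Rn R n => `|tnth x i|)).
Proof.
apply/integrableP; split.
  apply/measurable_EFinP; apply: measurableT_comp => //; exact: measurable_tnth.
have mG : measurable_fun setT (fun x : R => (`| `|x| |)%:E) .
  by apply/measurable_EFinP; apply: measurableT_comp.
rewrite (@ge0_integral_gaussian_tnth n i (fun x => (`| `|x| |)%:E))//.
by have /integrableP[_] := integrable_normal_abs R.
Qed.

Lemma gaussian_mean0 n (i : 'I_n) : \int[gaussian R n]_x tnth x i = 0.
Proof.
rewrite /Rintegral -[RHS]/(fine 0%E); congr fine; rewrite -(normal_mean0 R).
rewrite [LHS]integralE [RHS]integralE; congr (_ - _)%E.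
- rewrite -(@ge0_integral_gaussian_tnth n i (EFin^\+)%E)//; last exact: measurable_funepos.
  by apply: eq_integral => x _; rewrite !funeposE.
- rewrite -(@ge0_integral_gaussian_tnth n i (EFin^\-)%E)//; last exact: measurable_funeneg.
  by apply: eq_integral => x _; rewrite !funenegE.
Qed.

End gaussian_recursion.

(** * A Poincare inequality for the Ornstein-Uhlenbeck semigroup *)

Section ou.
Context (R : realType).
Notation N := (normal_prob (0 : R) 1).

Definition ou_avg n (a s : R) (f : Rn R n -> R) (y : Rn R n) : R :=
  \int[gaussian R n]_x f (lincomb a y s x).

(** The first Hermite coefficient, in direction i, of x |-> f (a y + s x); times
    a / s it is the i-th partial derivative of ou_avg a s f at y. *)
Definition ou_score n (a s : R) (f : Rn R n -> R) (i : 'I_n) (y : Rn R n) : R :=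
  \int[gaussian R n]_x (tnth x i * f (lincomb a y s x)).

Section basic.
Variables (n : nat) (a s : R) (f : Rn R n -> R).
Hypothesis mf : measurable_fun setT f.
Hypothesis f1 : forall x, `|f x| <= 1.

Lemma measurable_ou_kernel :
  measurable_fun setT (fun xy : Rn R n * Rn R n => f (lincomb a xy.2 s xy.1)).
Proof.
apply: (measurableT_comp mf).
exact: measurableT_comp (measurable_lincomb a s) (@measurable_swap _ _ (Rn R n) (Rn R n)).
Qed.

Lemma measurable_ou_section y : measurable_fun setT (fun x => f (lincomb a y s x)).
Proof. exact: measurableT_comp measurable_ou_kernel (pair2_measurable y). Qed.

Lemma measurable_ou_avg : measurable_fun setT (ou_avg a s f).
Proof.
exact: (bounded_measurable2 (gaussian R n) (gaussian R n) measurable_ou_kernel (fun=> f1 _)).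
Qed.

Lemma ou_avg_le1 y : `|ou_avg a s f y| <= 1.
Proof. exact: (bounded_le2 (gaussian R n) measurable_ou_kernel (fun p => f1 _) y). Qed.

Let i1 : (gaussian R n).-integrable setT (EFin \o cst (1 : R)).
Proof. exact: finite_measure_integrable_cst. Qed.

Let mx (i : 'I_n) : measurable_fun setT
  (fun xy : Rn R n * Rn R n => tnth xy.1 i * f (lincomb a xy.2 s xy.1)).
Proof.
apply: measurable_funM; last exact: measurable_ou_kernel.
exact: (measurableT_comp (measurable_tnth i) measurable_fst).
Qed.

Let dom (i : 'I_n) (x y : Rn R n) :
  `|tnth x i * f (lincomb a y s x)| <= `|tnth x i| * cst 1 y.
Proof. by rewrite normrM ler_wpM2l. Qed.

Lemma measurable_ou_score i : measurable_fun setT (ou_score a s f i).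
Proof. exact: (dominated_measurable2 (mx i) (integrable_gaussian_tnth R i) i1 (dom i)). Qed.

Lemma ou_score_le i y : `|ou_score a s f i y| <= \int[gaussian R n]_x `|tnth x i|.
Proof.
by have := dominated_le2 (mx i) (integrable_gaussian_tnth R i) (dom i) y; rewrite /= mulr1.
Qed.

End basic.

Section step.
Variables (n : nat) (a s : R) (f : Rn R n.+1 -> R).
Hypothesis s0 : s != 0.
Hypothesis mf : measurable_fun setT f.
Hypothesis f1 : forall x, `|f x| <= 1.

(** fhead smooths the last n coordinates of f around y' and leaves a function of
    the first coordinate; ftail smooths the first coordinate around y1 and leaves
    a function of the others. *)
Let fhead (y' : Rn R n) (u : R) : R :=
  \int[gaussian R n]_x f (Rn_cons (u, lincomb a y' s x)).

Let ftail (y1 : R) (z : Rn R n) : R :=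
  \int[N]_x f (Rn_cons (a * y1 + s * x, z)).

Let mfc : measurable_fun setT (f \o @Rn_cons R n).
Proof. exact: measurable_Rn_cons_comp. Qed.

Let mfhead2 y' : measurable_fun setT
  (fun p : R * Rn R n => f (Rn_cons (p.1, lincomb a y' s p.2))).
Proof.
apply: (measurableT_comp mfc); apply: measurable_fun_pair; first exact: measurable_fst.
have ml := measurableT_comp (@measurable_lincomb R n a s) (pair1_measurable y').
exact: (measurableT_comp ml measurable_snd).
Qed.

Let mftail2 y1 : measurable_fun setT
  (fun p : R * Rn R n => f (Rn_cons (a * y1 + s * p.1, p.2))).
Proof.
apply: (measurableT_comp mfc); apply: measurable_fun_pair; last exact: measurable_snd.
by apply: measurable_funD => //; exact: measurable_funM.
Qed.

Lemma measurable_fhead y' : measurable_fun setT (fhead y').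
Proof. exact: (bounded_measurable1 N (gaussian R n) (@mfhead2 y') (fun=> f1 _)). Qed.

Lemma fhead_le1 y' u : `|fhead y' u| <= 1.
Proof. exact: (bounded_le1 (gaussian R n) (@mfhead2 y') (fun=> f1 _) u). Qed.

Lemma measurable_ftail y1 : measurable_fun setT (ftail y1).
Proof. exact: (bounded_measurable2 N (gaussian R n) (@mftail2 y1) (fun=> f1 _)). Qed.

Lemma ftail_le1 y1 z : `|ftail y1 z| <= 1.
Proof. exact: (bounded_le2 N (@mftail2 y1) (fun=> f1 _) z). Qed.

Let shiftE (y1 x1 : R) : a * y1 + s * x1 = s * (x1 + a / s * y1).
Proof. by field. Qed.

Let i1 m : (gaussian R m).-integrable setT (EFin \o cst (1 : R)).
Proof. exact: finite_measure_integrable_cst. Qed.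

Let iN1 : N.-integrable setT (EFin \o cst (1 : R)).
Proof. exact: finite_measure_integrable_cst. Qed.

(** Smoothing the last coordinates and then the first one gives the full
    average. On the line a y1 + s x1 = s (x1 + (a / s) y1), so the parameter of
    heat1 is a / s and its function is rescaled by s. *)
Lemma heat1_fhead y1 y' :
  ou_avg a s f (Rn_cons (y1, y')) = heat1 (fun u => fhead y' (s * u)) (a / s) y1.
Proof.
rewrite /ou_avg (bounded_Rintegral_gaussianS (measurable_ou_section a s mf _) (fun=> f1 _)).
apply: eq_Rintegral => x1 _; apply: eq_Rintegral => x' _.
by rewrite lincomb_Rn_cons/= shiftE.
Qed.

Lemma heat1_score_fhead y1 y' :
  ou_score a s f ord0 (Rn_cons (y1, y'))
  = heat1_score (fun u => fhead y' (s * u)) (a / s) y1.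
Proof.
pose G (x : Rn R n.+1) := tnth x ord0 * f (lincomb a (Rn_cons (y1, y')) s x).
have mG : measurable_fun setT G.
  by apply: measurable_funM; [exact: measurable_tnth|exact: measurable_ou_section].
have mGc := measurable_Rn_cons_comp mG.
have dom x1 x' : `|(G \o @Rn_cons R n) (x1, x')| <= `|x1| * cst 1 x'.
  by rewrite /= /G tnth_Rn_cons0 normrM ler_wpM2l.
rewrite /ou_score (Rintegral_gaussianS mG); last first.
  exact: dominated_integrable_prod mGc (integrable_normal_abs R) (@i1 n) dom.
rewrite (dominated_fubini1 mGc (integrable_normal_abs R) (@i1 n) dom).
apply: eq_Rintegral => x1 _; rewrite -RintegralZl//; last first.
  apply: (@bounded_integrable _ _ _ _ _ 1) => //.
  exact: (measurableT_comp (@mfhead2 y') (pair1_measurable _)).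
apply: eq_Rintegral => x' _.
by rewrite /= /G tnth_Rn_cons0 lincomb_Rn_cons/= shiftE.
Qed.

Lemma ou_avg_ftail y1 y' : ou_avg a s f (Rn_cons (y1, y')) = ou_avg a s (ftail y1) y'.
Proof.
rewrite /ou_avg (bounded_Rintegral_gaussianS (measurable_ou_section a s mf _) (fun=> f1 _)).
have mGc := measurable_Rn_cons_comp (measurable_ou_section a s mf (Rn_cons (y1, y'))).
rewrite (bounded_fubini N (gaussian R n) mGc (fun=> f1 _)).
apply: eq_Rintegral => x' _; apply: eq_Rintegral => x1 _.
by rewrite /= lincomb_Rn_cons.
Qed.

Lemma ou_score_ftail y1 y' i :
  ou_score a s f (lift ord0 i) (Rn_cons (y1, y')) = ou_score a s (ftail y1) i y'.
Proof.
pose G (x : Rn R n.+1) := tnth x (lift ord0 i) * f (lincomb a (Rn_cons (y1, y')) s x).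
have mG : measurable_fun setT G.
  by apply: measurable_funM; [exact: measurable_tnth|exact: measurable_ou_section].
have mGc := measurable_Rn_cons_comp mG.
have dom x1 x' : `|(G \o @Rn_cons R n) (x1, x')| <= cst 1 x1 * `|tnth x' i|.
  by rewrite /= /G tnth_Rn_consS normrM mul1r ler_piMr.
rewrite /ou_score (Rintegral_gaussianS mG); last first.
  exact: dominated_integrable_prod mGc iN1 (integrable_gaussian_tnth R i) dom.
rewrite (dominated_fubini2 mGc iN1 (integrable_gaussian_tnth R i) dom).
apply: eq_Rintegral => x' _; rewrite -RintegralZl//; last first.
  apply: (@bounded_integrable _ _ _ _ _ 1) => //.
  exact: (measurableT_comp (@mftail2 y1) (pair2_measurable _)).
apply: eq_Rintegral => x1 _.
by rewrite /= /G tnth_Rn_consS lincomb_Rn_cons.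
Qed.

Let H (p : R * Rn R n) := ou_avg a s f (Rn_cons p).
Let S i (p : R * Rn R n) := ou_score a s f i (Rn_cons p).

(** Efron-Stein for (y1, y') |-> ou_avg a s f (y1, y'): for fixed y' the average
    is heat1 of fhead, to which the inequality on the line applies; for fixed y1
    it is ou_avg of ftail, to which the induction hypothesis applies. The scores
    correspond exactly, so the constant does not grow with the dimension. *)
Lemma poincare_ou_step :
  (forall g : Rn R n -> R, measurable_fun setT g -> (forall x, `|g x| <= 1) ->
   \int[gaussian R n]_y (ou_avg a s g y ^+ 2) - (\int[gaussian R n]_y ou_avg a s g y) ^+ 2
   <= 2 * (a / s) ^+ 2 * \sum_(i < n) \int[gaussian R n]_y (ou_score a s g i y ^+ 2)) ->
  \int[gaussian R n.+1]_y (ou_avg a s f y ^+ 2) - (\int[gaussian R n.+1]_y ou_avg a s f y) ^+ 2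
  <= 2 * (a / s) ^+ 2 * \sum_(i < n.+1) \int[gaussian R n.+1]_y (ou_score a s f i y ^+ 2).
Proof.
move=> IH; set r := a / s.
have mavg := measurable_ou_avg a s mf f1.
have avg1 y := ou_avg_le1 a s mf f1 y.
have mH : measurable_fun setT H by have := measurable_Rn_cons_comp mavg.
have H1 p : `|H p| <= 1 by exact: avg1.
have mscore i := measurable_ou_score a s mf f1 i.
pose C i := \int[gaussian R n.+1]_x `|tnth x i|.
have scoreC i y : `|ou_score a s f i y| <= C i by exact: ou_score_le.
have mscore2 i : measurable_fun setT (fun y => ou_score a s f i y ^+ 2) by exact: measurable_funX.
have score2C i y : `|ou_score a s f i y ^+ 2| <= C i ^+ 2 by exact: normr_sqr_le.
have mS2 i : measurable_fun setT (fun p => S i p ^+ 2).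
  exact: (measurable_Rn_cons_comp (mscore2 i)).
have S2C i p : `|S i p ^+ 2| <= C i ^+ 2 by exact: score2C.
rewrite (bounded_Rintegral_gaussianS mavg avg1).
rewrite (@bounded_Rintegral_gaussianS _ _ _ (1 ^+ 2)); last 2 first.
- exact: measurable_funX.
- by move=> y; exact: normr_sqr_le.
apply: (le_trans (efron_stein N (gaussian R n) mH H1)).
rewrite big_ord_recl mulrDr; apply: lerD.
  rewrite (bounded_Rintegral_gaussianS (mscore2 ord0) (score2C ord0)).
  rewrite (bounded_fubini N (gaussian R n) (mS2 ord0) (S2C ord0)).
  have ib : (gaussian R n).-integrable setT (EFin \o (fun y' => \int[N]_y1 (S ord0 (y1, y') ^+ 2))).
    apply: (@bounded_integrable _ _ _ _ _ (C ord0 ^+ 2)).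
      exact: (bounded_measurable2 N (gaussian R n) (mS2 ord0) (S2C ord0)).
    by move=> y'; exact: (bounded_le2 N (mS2 ord0) (S2C ord0) y').
  rewrite -RintegralZl//; apply: le_Rintegral => //.
  - exact: (integrable_variance2 N (gaussian R n) mH H1).
  - exact: (integrableZl measurableT (2 * r ^+ 2) ib).
  move=> y' _.
  have mF : measurable_fun setT (fun u => fhead y' (s * u)).
    by apply: measurableT_comp; [exact: measurable_fhead|exact: measurable_funM].
  have := poincare_heat1 r mF (fun u => fhead_le1 y' (s * u)).
  under eq_Rintegral do rewrite -heat1_fhead.
  under [X in _ - X ^+ 2 <= _]eq_Rintegral do rewrite -heat1_fhead.
  by under [X in _ <= _ * X]eq_Rintegral do rewrite -heat1_score_fhead.
have ib i : N.-integrable setT (EFin \o (fun y1 => \int[gaussian R n]_y' (S i (y1, y') ^+ 2))).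
  apply: (@bounded_integrable _ _ _ _ _ (C i ^+ 2)).
    exact: (bounded_measurable1 N (gaussian R n) (mS2 i) (S2C i)).
  by move=> y1; exact: (bounded_le1 (gaussian R n) (mS2 i) (S2C i) y1).
have [isum sumE] := Rintegral_sum (index_enum 'I_n) (fun i => ib (lift ord0 i)).
under eq_bigr => i _ do
  rewrite (bounded_Rintegral_gaussianS (mscore2 (lift ord0 i)) (score2C (lift ord0 i))).
rewrite -sumE -RintegralZl//; apply: le_Rintegral => //.
- exact: (integrable_variance1 N (gaussian R n) mH H1).
- exact: (integrableZl measurableT (2 * r ^+ 2) isum).
move=> y1 _; have := IH _ (measurable_ftail y1) (ftail_le1 y1).
under eq_Rintegral do rewrite -ou_avg_ftail.
under [X in _ - X ^+ 2 <= _]eq_Rintegral do rewrite -ou_avg_ftail.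
by under eq_bigr => i _ do under eq_Rintegral do rewrite -ou_score_ftail.
Qed.

End step.

Lemma poincare_ou n (a s : R) (f : Rn R n -> R) : s != 0 ->
  measurable_fun setT f -> (forall x, `|f x| <= 1) ->
  \int[gaussian R n]_y (ou_avg a s f y ^+ 2) - (\int[gaussian R n]_y ou_avg a s f y) ^+ 2
  <= 2 * (a / s) ^+ 2 * \sum_(i < n) \int[gaussian R n]_y (ou_score a s f i y ^+ 2).
Proof.
move=> s0; elim: n f => [f mf f1|n IH f mf f1]; last exact: poincare_ou_step.
rewrite big_ord0 mulr0.
have -> : ou_avg a s f = cst (ou_avg a s f [tuple]).
  by apply/funext => y; rewrite [y]tuple0.
by rewrite /= !(@Rintegral_prob_cst _ _ _ (gaussian R 0)) subrr.
Qed.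

End ou.

(** * Covariance with half-spaces *)

Section covariance_Rintegral.
Context d (T : measurableType d) (R : realType) (P : probability T R).

Lemma expectation_Rintegral (X : T -> R) : fine 'E_P[X] = \int[P]_x X x.
Proof. by rewrite unlock. Qed.

Lemma covariance_Rintegral (X Y : T -> R) (C D : R) :
  measurable_fun setT X -> measurable_fun setT Y ->
  (forall x, `|X x| <= C) -> (forall x, `|Y x| <= D) ->
  covariance P X Y =
  (\int[P]_x ((X x - \int[P]_z X z) * (Y x - \int[P]_z Y z)))%:E.
Proof.
move=> mX mY XC YD.
rewrite unlock !expectation_Rintegral [in LHS]unlock EFin_Rintegral//.
apply: (@bounded_integrable _ _ _ _ _ ((C + C) * (D + D))).
  by apply: measurable_funM; exact: measurable_funB.
move=> x; rewrite normrM ler_pM// (le_trans (ler_normB _ _))// lerD//.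
  exact: bounded_Rintegral.
exact: bounded_Rintegral.
Qed.

Lemma Rintegral_centered (Y : T -> R) (D : R) :
  measurable_fun setT Y -> (forall x, `|Y x| <= D) ->
  \int[P]_x (Y x - \int[P]_z Y z) = 0.
Proof.
move=> mY YD; rewrite RintegralB//; first by rewrite Rintegral_prob_cst subrr.
- exact: bounded_integrable mY YD.
- exact: finite_measure_integrable_cst.
Qed.

(** Since Y minus its mean is centered, the mean of the indicator contributes
    nothing. *)
Lemma covariance_indic (A : set T) (Y : T -> R) (D : R) : measurable A ->
  measurable_fun setT Y -> (forall x, `|Y x| <= D) ->
  covariance P (\1_A) Y = (\int[P]_x (\1_A x * (Y x - \int[P]_z Y z)))%:E.
Proof.
move=> mA mY YD; have m1 : measurable_fun setT (\1_A : T -> R) by exact: measurable_indic.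
have A1 x : `|\1_A x : R| <= 1 by rewrite ger0_norm// indicE; case: (_ \in _).
rewrite (covariance_Rintegral m1 mY A1 YD); congr EFin.
set p := \int[P]_z \1_A z; set e := \int[P]_z Y z.
have eD : `|e| <= D by exact: bounded_Rintegral.
have mYe : measurable_fun setT (fun x => Y x - e) by exact: measurable_funB.
have YeD x : `|Y x - e| <= D + D by rewrite (le_trans (ler_normB _ _))// lerD.
have iYe := bounded_integrable P mYe YeD.
transitivity (\int[P]_x (\1_A x * (Y x - e) - p * (Y x - e))).
  by apply: eq_Rintegral => x _; rewrite mulrBl.
rewrite RintegralB//; last 2 first.
- apply: (@bounded_integrable _ _ _ _ _ (1 * (D + D))); first exact: measurable_funM.
  by move=> x; rewrite normrM ler_pM.
- exact: (integrableZl measurableT p iYe).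
by rewrite RintegralZl// (Rintegral_centered mY YD) mulr0 subr0.
Qed.

End covariance_Rintegral.

Section halfspace.
Context (R : realType).
Notation N := (normal_prob (0 : R) 1).

Lemma measurable_dotp n (b : Rn R n) : measurable_fun setT (fun x : Rn R n => dotp x b).
Proof.
apply: measurable_sum => i; apply: measurable_funM => //; exact: measurable_tnth.
Qed.

Lemma measurable_halfspace n (A : set (Rn R n)) : halfspace A -> measurable A.
Proof.
move=> [a [b ->]]; apply: measurable_le_set; last exact: measurable_cst.
exact: measurable_dotp.
Qed.

Lemma dotp_Rn_cons n (p : R * Rn R n) (b : Rn R n.+1) :
  dotp (Rn_cons p) b
  = p.1 * tnth b ord0 + dotp p.2 [tuple tnth b (lift ord0 i) | i < n].
Proof.
rewrite /dotp big_ord_recl tnth_Rn_cons0; congr (_ + _).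
by apply: eq_bigr => i _; rewrite tnth_Rn_consS tnth_mktuple.
Qed.

Lemma normal_affine_second_moment (c e : R) :
  (\int[N]_u ((u * c + e) ^+ 2)%:E <= (4 * c ^+ 2 + e ^+ 2)%:E)%E.
Proof.
have i2 := integrable_normal_sqr R; have i1 := integrable_normal_id R.
have ie : N.-integrable setT (EFin \o (fun u : R => e ^+ 2)).
  exact: finite_measure_integrable_cst.
have i2c := integrableZl measurableT (c ^+ 2) i2.
have i1c := integrableZl measurableT (2 * c * e) i1.
have -> : (\int[N]_u ((u * c + e) ^+ 2)%:E)%E
    = (\int[N]_u ((c ^+ 2 * u ^+ 2 + 2 * c * e * u) + e ^+ 2))%:E.
  rewrite EFin_Rintegral//; last first.
    exact: (integrableD measurableT (integrableD measurableT i2c i1c) ie).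
  by apply: eq_integral => u _; congr EFin; ring.
rewrite RintegralD//; last exact: (integrableD measurableT i2c i1c).
rewrite (@Rintegral_prob_cst _ _ _ N) RintegralD// !RintegralZl//.
have -> : \int[N]_u u = 0 by rewrite /Rintegral normal_mean0.
have : \int[N]_u (u ^+ 2) <= 4.
  rewrite -lee_fin EFin_Rintegral//; exact: normal_second_moment.
move=> h; rewrite lee_fin mulr0 addr0 lerD2r mulrC ler_wpM2r ?sqr_ge0//.
Qed.

(** By induction on the dimension; the cross term vanishes because the first
    coordinate has mean zero, see normal_affine_second_moment. *)
Lemma second_moment_dotp n (b : Rn R n) :
  (\int[gaussian R n]_x (dotp x b ^+ 2)%:E <= (4 * \sum_(i < n) tnth b i ^+ 2)%:E)%E.
Proof.
elim: n b => [b|n IH b].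
  under eq_integral do rewrite /dotp big_ord0 expr0n/=.
  by rewrite integral0 big_ord0 mulr0.
have mL : measurable_fun setT (fun x : Rn R n.+1 => (dotp x b ^+ 2)%:E).
  by apply/measurable_EFinP; apply: measurable_funX; exact: measurable_dotp.
rewrite ge0_integral_gaussianS//; last by move=> x; rewrite lee_fin sqr_ge0.
set b' := [tuple tnth b (lift ord0 i) | i < n].
apply: (@le_trans _ _ (\int[gaussian R n]_y ((4 * tnth b ord0 ^+ 2)%:E + (dotp y b' ^+ 2)%:E))%E).
  apply: ge0_le_integral_nomeasurable => y.
    by apply: integral_ge0 => x _; rewrite lee_fin sqr_ge0.
  under eq_integral do rewrite dotp_Rn_cons/=.
  by rewrite -EFinD; exact: normal_affine_second_moment.
rewrite ge0_integralD//; last 3 first.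
- by move=> y _; rewrite lee_fin mulr_ge0 ?sqr_ge0.
- by move=> y _; rewrite lee_fin sqr_ge0.
- by apply/measurable_EFinP; apply: measurable_funX; exact: measurable_dotp.
rewrite integral_prob_cst big_ord_recl mulrDr EFinD leeD2l//.
apply: le_trans (IH b') _; rewrite lee_fin; under eq_bigr do rewrite tnth_mktuple.
by [].
Qed.

End halfspace.

Section clamp.
Context (R : realType).
Notation mu := (@lebesgue_measure R).

Definition clamp (l : R) : R := Num.max (- 2) (Num.min l 2).

Lemma clampE (l : R) : clamp l = if l < - 2 then - 2 else if l < 2 then l else 2.
Proof.
rewrite /clamp; case: (ltP l (-2)) => h1.
  by rewrite min_l ?max_l//; lra.
by case: (ltP l 2) => h2; rewrite max_r//; lra.
Qed.

Lemma clamp_bound (l : R) : 0 <= clamp l + 2 <= 4.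
Proof. by rewrite clampE; case: ltP => h1; [|case: ltP => h2]; apply/andP; split; lra. Qed.

(** (|l| - 4)^2 >= 0. The level 2 is chosen so that the factor 1/8, times the
    second moment bound 4, is less than 1. *)
Lemma clamp_error (l : R) : `|l - clamp l| <= l ^+ 2 / 8.
Proof.
have h4 := sqr_ge0 (l - 4); have h5 := sqr_ge0 (l + 4); have h0 := sqr_ge0 l.
rewrite clampE; case: ltP => h1; [|case: ltP => h2].
- by rewrite ltr0_norm; lra.
- by rewrite subrr normr0; lra.
- by rewrite ger0_norm; lra.
Qed.

(** The layer-cake formula: clamp l + 2 is the length of the set of levels in
    [-2, 2] below l. *)
Lemma Rintegral_clamp (l k : R) :
  \int[mu]_s (\1_[set s | s <= l] s * \1_(`[-2, 2]%classic) s * k) = (clamp l + 2) * k.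
Proof.
have -> : (fun s => \1_[set s | s <= l] s * \1_(`[-2, 2]%classic) s * k)
    = (fun s => k * \1_(`[-2, Num.min l 2]%classic) s).
  apply/funext => s; rewrite mulrC; congr (_ * _); rewrite !indicE -natrM mulnb.
  congr (nat_of_bool _)%:R; apply/idP/idP.
    by move=> /andP[]; rewrite !inE/= !in_itv/= le_min => -> /andP[-> ->].
  rewrite inE/= in_itv/= le_min => /andP[h1 /andP[h2 h3]].
  by apply/andP; split; rewrite inE/= ?in_itv/= ?h1.
have fin : (mu `[(-2)%R, (Num.min l 2)%R] < +oo)%E.
  by rewrite /= lebesgue_measure_itv/=; case: ifP => _; rewrite -?EFinB ltry.
rewrite RintegralZl//; last first.
  apply/integrableP; split; first exact/measurable_EFinP.
  under eq_integral do rewrite /= ger0_norm//.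
  by rewrite integral_indic//= setIT.
rewrite mulrC; congr (_ * _).
rewrite /Rintegral integral_indic// setIT /= lebesgue_measure_itv/= lte_fin.
rewrite clampE; case: (ltP l (-2)) => h1.
  rewrite min_l; last by lra.
  by rewrite ifF/=; [lra|apply/negbTE; rewrite -leNgt; lra].
case: (ltP l 2) => h2.
  case: ifPn => h3; first by rewrite -EFinB/=; lra.
  by rewrite -leNgt in h3; rewrite /=; lra.
rewrite ifT; last by lra.
by rewrite -EFinB/=; lra.
Qed.

End clamp.

Section maxcov.
Context (R : realType) (n : nat) (g : Rn R n -> R).
Notation mu := (@lebesgue_measure R).
Notation gam := (gaussian R n).
Hypothesis mg : measurable_fun setT g.
Hypothesis g01 : forall x, 0 <= g x <= 1.

Let g1 x : `|g x| <= 1.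
Proof. by have /andP[? ?] := g01 x; rewrite ger0_norm. Qed.

Lemma max_halfspace_cov_ge0 : (0 <= max_halfspace_cov g)%E.
Proof.
(* the empty set is the half-space <x, 0> <= -1 *)
apply: ereal_sup_ubound; exists set0.
  exists [tuple 0 | i < n], (-1); apply/seteqP; split => // x /=.
  rewrite /dotp big1 ?lerN10// => [|i _]; last by rewrite tnth_mktuple mulr0.
  by lra.
rewrite (covariance_indic gam measurable0 mg g1).
by under eq_Rintegral do rewrite indic0 mul0r; rewrite Rintegral_prob_cst.
Qed.

Let e := \int[gam]_x g x.
Let gt x := g x - e.

Let e01 : 0 <= e <= 1.
Proof.
apply/andP; split; first by apply: Rintegral_ge0 => x _; have /andP[] := g01 x.
by apply: le_trans (ler_norm _) (bounded_Rintegral _ mg g1).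
Qed.

Let mgt : measurable_fun setT gt.
Proof. exact: measurable_funB. Qed.

Let gt1 x : `|gt x| <= 1.
Proof.
have /andP[e0 e1] := e01; have /andP[gx0 gx1] := g01 x.
by rewrite ler_norml /gt; apply/andP; split; lra.
Qed.

Let b : Rn R n := [tuple \int[gam]_x (tnth x i * g x) | i < n].
Let L x := dotp x b.
Let S := \sum_(i < n) tnth b i ^+ 2.

Let integrable_coord_mul (k : Rn R n -> R) i : measurable_fun setT k ->
  (forall x, `|k x| <= 1) -> gam.-integrable setT (EFin \o (fun x => tnth x i * k x)).
Proof.
move=> mk k1; apply: (integrable_dominated _ (integrable_gaussian_tnth R i)).
  by apply: measurable_funM => //; exact: measurable_tnth.
by move=> x; rewrite normrM ler_piMr.
Qed.

Let integrable_coord i : gam.-integrable setT (EFin \o (fun x => tnth x i)).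
Proof.
by apply: (integrable_dominated _ (integrable_gaussian_tnth R i)) => //; exact: measurable_tnth.
Qed.

(** Each coordinate has mean zero, so centering g does not change its first
    Hermite coefficients. *)
Let integral_Lgt :
  gam.-integrable setT (EFin \o (fun x => L x * gt x)) /\ \int[gam]_x (L x * gt x) = S.
Proof.
have iX i := integrable_coord_mul i mgt gt1.
have ibX i : gam.-integrable setT (EFin \o (fun x => tnth b i * (tnth x i * gt x))).
  exact: (integrableZl measurableT (tnth b i) (iX i)).
have LE : (fun x => L x * gt x) = (fun x => \sum_(i < n) tnth b i * (tnth x i * gt x)).
  apply/funext => x; rewrite /L /dotp mulr_suml; apply: eq_bigr => i _; ring.
have [iS SE] := Rintegral_sum (index_enum 'I_n) ibX.
rewrite LE; split => //; rewrite SE; apply: eq_bigr => i _.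
rewrite RintegralZl// expr2; congr (_ * _); rewrite [RHS]tnth_mktuple.
transitivity (\int[gam]_x (tnth x i * g x - e * tnth x i)).
  by apply: eq_Rintegral => x _; rewrite /gt; ring.
rewrite RintegralB//; last exact: (integrableZl measurableT e (integrable_coord i)).
  by rewrite RintegralZl// gaussian_mean0 mulr0 subr0.
exact: integrable_coord_mul.
Qed.

Let mL : measurable_fun setT L.
Proof. exact: measurable_dotp. Qed.

Let iL2 : gam.-integrable setT (EFin \o (fun x => L x ^+ 2)).
Proof.
apply/integrableP; split; first by apply/measurable_EFinP; exact: measurable_funX.
under eq_integral do rewrite /= ger0_norm ?sqr_ge0//.
exact: le_lt_trans (second_moment_dotp b) (ltry _).
Qed.

Let L2 : \int[gam]_x (L x ^+ 2) <= 4 * S.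
Proof. by rewrite -lee_fin EFin_Rintegral//; exact: second_moment_dotp. Qed.

Let mclamp : measurable_fun setT (fun x => clamp (L x) + 2).
Proof.
apply: measurable_funD => //; apply: measurable_maxr => //; exact: measurable_minr.
Qed.

Let clamp4 x : `|(clamp (L x) + 2) * gt x| <= 4 * 1.
Proof.
by have /andP[c0 c4] := clamp_bound (L x); rewrite normrM ler_pM// ger0_norm.
Qed.

(** By the layer-cake formula and Fubini, the left-hand side is the integral
    over s in [-2, 2] of the covariances with the sets {L >= s}, and these are
    the half-spaces <x, - b> <= - s. *)
Let integral_clamp_le (m : R) :
  (forall A : set (Rn R n), halfspace A -> \int[gam]_x (\1_A x * gt x) <= m) ->
  \int[gam]_x ((clamp (L x) + 2) * gt x) <= 4 * m.
Proof.
move=> hm.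
pose F (p : Rn R n * R) := \1_[set p : Rn R n * R | p.2 <= L p.1] p
   * \1_(`[-2, 2]%classic) p.2 * gt p.1.
have mF : measurable_fun setT (F : Rn R n * measurableTypeR R -> R).
  apply: measurable_funM; last exact: (measurableT_comp mgt measurable_fst).
  apply: measurable_funM.
    apply: measurable_indic; apply: measurable_le_set; first exact: measurable_snd.
    exact: (measurableT_comp mL measurable_fst).
  by apply: measurableT_comp; [exact: measurable_indic|exact: measurable_snd].
have ImuE : (\int[mu]_s (\1_(`[-2, 2]%classic) s)%:E = 4%:E)%E.
  rewrite integral_indic//= setIT lebesgue_measure_itv/= lte_fin ifT; last by lra.
  by rewrite -EFinB; congr EFin; lra.
have iI : mu.-integrable setT (EFin \o (\1_(`[-2, 2]%classic) : R -> R)).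
  apply/integrableP; split; first exact/measurable_EFinP.
  by under eq_integral do rewrite /= ger0_norm//; rewrite ImuE ltry.
have i1 : gam.-integrable setT (EFin \o cst (1 : R)) by exact: finite_measure_integrable_cst.
have dom x s : `|F (x, s)| <= cst 1 x * \1_(`[-2, 2]%classic) s.
  rewrite /F !normrM (ger0_norm (_ : 0 <= \1_(`[-2, 2]%classic) s))// mulrAC ler_wpM2r//.
  rewrite -[leRHS]mulr1 ler_pM// ger0_norm// indicE; by case: (_ \in _).
have -> : \int[gam]_x ((clamp (L x) + 2) * gt x) = \int[gam]_x \int[mu]_s F (x, s).
  by apply: eq_Rintegral => x _; rewrite -Rintegral_clamp.
rewrite -(dominated_fubini1 mF i1 iI dom) (dominated_fubini2 mF i1 iI dom).
have -> : 4 * m = \int[mu]_s (m * \1_(`[-2, 2]%classic) s).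
  by rewrite RintegralZl// /Rintegral ImuE mulrC.
apply: le_Rintegral => //.
- apply: (@integrable_dominated _ _ R mu _
    (fun s => (\int[gam]_x cst 1 x) * \1_(`[-2, 2]%classic) s)).
  + exact: dominated_measurable2 mF i1 iI dom.
  + exact: (integrableZl measurableT _ iI).
  + exact: (dominated_le2 mF i1 dom).
- exact: (integrableZl measurableT m iI).
move=> s _.
pose A := [set x : Rn R n | s <= L x].
have hA : halfspace A.
  exists [tuple - tnth b i | i < n], (- s); apply/seteqP.
  have dN x : dotp x [tuple - tnth b i | i < n] = - L x.
    by rewrite /L /dotp -sumrN; apply: eq_bigr => i _; rewrite tnth_mktuple mulrN.
  by split => x; rewrite /A /= dN lerN2.
have iA : gam.-integrable setT (EFin \o (fun x => \1_A x * gt x)).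
  apply: (@bounded_integrable _ _ _ _ _ (1 * 1)).
    by apply: measurable_funM => //; apply: measurable_indic; exact: measurable_halfspace.
  by move=> x; rewrite normrM ler_pM// ger0_norm// indicE; case: (_ \in _).
have -> : \int[gam]_x F (x, s) = \int[gam]_x (\1_(`[-2, 2]%classic) s * (\1_A x * gt x)).
  apply: eq_Rintegral => x _; rewrite /F mulrA; congr (_ * _); rewrite mulrC; congr (_ * _).
by rewrite RintegralZl// mulrC ler_wpM2r//; exact: hm.
Qed.

(** With S = |b|^2 = E L (g - E g), split L into its truncation and the error:
    the first contributes at most 4 m by integral_clamp_le, where m is the
    supremum, and the second at most E L^2 / 8 <= S / 2. Hence S <= 8 m. *)
Lemma sqr_barycenter_le_max_halfspace_cov :
  ((8^-1 * \sum_(i < n) (\int[gam]_x (tnth x i * g x)) ^+ 2)%:E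
    <= max_halfspace_cov g)%E.
Proof.
have -> : \sum_(i < n) (\int[gam]_x (tnth x i * g x)) ^+ 2 = S.
  by apply: eq_bigr => i _; rewrite tnth_mktuple.
have := max_halfspace_cov_ge0.
case ME : (max_halfspace_cov g) => [m| |]// m0; last exact: leey.
have hm (A : set (Rn R n)) : halfspace A -> \int[gam]_x (\1_A x * gt x) <= m.
  move=> hA; rewrite -lee_fin -ME -(covariance_indic gam (measurable_halfspace hA) mg g1).
  by apply: ereal_sup_ubound; exists A.
have cm := integral_clamp_le hm.
have [iLgt LgtE] := integral_Lgt.
have ic : gam.-integrable setT (EFin \o (fun x => (clamp (L x) + 2) * gt x)).
  by apply: (@bounded_integrable _ _ _ _ _ (4 * 1)) => //; exact: measurable_funM.
have igt : gam.-integrable setT (EFin \o gt) by exact: bounded_integrable mgt gt1.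
have i2gt := integrableZl measurableT 2 igt.
have i8 := integrableZl measurableT (8^-1) iL2.
(* the term - 2 gt undoes the shift of clamp L by 2 and integrates to zero *)
have : S <= \int[gam]_x (((clamp (L x) + 2) * gt x - 2 * gt x) + 8^-1 * L x ^+ 2).
  rewrite -LgtE; apply: le_Rintegral => //.
    exact: (integrableD measurableT (integrableB measurableT ic i2gt) i8).
  move=> x _; rewrite -lerBlDl.
  rewrite (_ : _ - _ = (L x - clamp (L x)) * gt x); last by ring.
  apply: le_trans (ler_norm _) _; rewrite normrM.
  apply: (@le_trans _ _ (`|L x - clamp (L x)| * 1)); first by rewrite ler_wpM2l.
  by rewrite mulr1 mulrC; exact: clamp_error.
rewrite RintegralD//; last exact: (integrableB measurableT ic i2gt).
rewrite RintegralB// !RintegralZl// (Rintegral_centered gam mg g1) mulr0 subr0.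
by rewrite lee_fin => h; have := L2; lra.
Qed.

End maxcov.

(** * The theorem *)

Lemma lincombC (R : realType) n (a s : R) (x y : Rn R n) :
  lincomb a y s x = lincomb s x a y.
Proof. by apply: eq_from_tnth => i; rewrite !tnth_mktuple addrC. Qed.

Theorem theorem2p1 (R : realType) :
  exists2 c : R, 0 < c &
    forall (n : nat) (f : Rn R n -> R) (t : R),
      (1 <= n)%N ->
      measurable_fun setT f ->
      (forall x, 0 <= f x <= 1) ->
      0 < t ->
      ((c * (expR (2 * t) - 1))%:E * variance (gaussian R n) (ou_semigroup t f)
        <= \int[gaussian R n]_y max_halfspace_cov (ou_slice t y f))%E.
Proof.
(* 16 = 8 * 2: 8 from the half-space bound, 2 from the Poincare inequality *)
exists (16^-1); first by rewrite invr_gt0.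
move=> n f t _ mf f01 t0.
have f1 x : `|f x| <= 1 by have /andP[? ?] := f01 x; rewrite ger0_norm.
set a := expR (- t); set s := Num.sqrt (1 - expR (- (2 * t))).
have e2 : expR (- (2 * t)) = a ^+ 2 by rewrite /a -expRM_natl; congr expR; ring.
have e1 : a ^+ 2 * expR (2 * t) = 1 by rewrite -e2 -expRD addNr expR0.
have s_gt0 : 0 < s by rewrite sqrtr_gt0 subr_gt0 expR_lt1; lra.
have s2 : s ^+ 2 = 1 - a ^+ 2 by rewrite sqr_sqrtr ?e2// -e2 subr_ge0 expR_le1; lra.
have scale : (a / s) ^+ 2 * (expR (2 * t) - 1) = 1.
  rewrite expr_div_n s2 mulrAC mulrBr e1 mulr1 divff//.
  by rewrite -s2 sqrf_eq0 gt_eqF.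
have ouE : ou_semigroup t f = ou_avg a s f.
  by apply/funext => y; rewrite /ou_semigroup expectation_Rintegral.
have mX := measurable_ou_avg a s mf f1; have X1 := ou_avg_le1 a s mf f1.
rewrite ouE /variance (covariance_Rintegral _ mX mX X1 X1).
rewrite [X in (_ * X%:E)%E](_ : _ = \int[gaussian R n]_y (ou_avg a s f y ^+ 2)
    - (\int[gaussian R n]_y ou_avg a s f y) ^+ 2); last first.
  have := Rintegral_sqr_center (gaussian R n) (\int[gaussian R n]_y ou_avg a s f y) mX X1.
  by rewrite subrr expr0n/= addr0 => <-.
pose I i := \int[gaussian R n]_y (ou_score a s f i y ^+ 2).
have iS i : (gaussian R n).-integrable setT (EFin \o (fun y => ou_score a s f i y ^+ 2)).
  apply: (@bounded_integrable _ _ _ _ _ ((\int[gaussian R n]_x `|tnth x i|) ^+ 2)).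
    by apply: measurable_funX; exact: measurable_ou_score.
  by move=> y; apply: normr_sqr_le; exact: ou_score_le.
have [iSum SumE] := Rintegral_sum (index_enum 'I_n) iS.
apply: (@le_trans _ _ (8^-1 * \sum_(i < n) I i)%:E).
  have pos : 0 <= expR (2 * t) - 1 by rewrite subr_ge0 ltW ?expR_gt1; lra.
  have := poincare_ou a (lt0r_neq0 s_gt0) mf f1.
  rewrite -EFinM lee_fin -/(I _) => /(ler_wpM2l pos) h.
  have -> : 8^-1 * \sum_(i < n) I i = 16^-1 * ((expR (2 * t) - 1) *
      (2 * (a / s) ^+ 2 * \sum_(i < n) I i)).
    rewrite (_ : _ * (2 * _ * _)
      = 2 * ((a / s) ^+ 2 * (expR (2 * t) - 1)) * \sum_(i < n) I i); last by ring.
    by rewrite scale; field.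
  by rewrite -[leLHS]mulrA ler_wpM2l// invr_ge0.
rewrite -SumE -RintegralZl// EFin_Rintegral//; last exact: (integrableZl measurableT _ iSum).
apply: ge0_le_integral_nomeasurable => y.
  by rewrite lee_fin mulr_ge0 ?invr_ge0// sumr_ge0// => i _; exact: sqr_ge0.
have sliceE : ou_slice t y f = (fun x => f (lincomb a y s x)).
  by apply/funext => x; rewrite /ou_slice -lincombC.
rewrite sliceE; apply: sqr_barycenter_le_max_halfspace_cov => //.
exact: measurable_ou_section.
Qed.
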